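(* For $\sigma,\rho\in\mathfrak{S}_n$, there are the following isomorphisms of $H_n(0)$-modules. (1) $\phi[\mathsf{B}(\sigma,\rho)]\cong\mathsf{B}(\sigma^{w_0},\rho^{w_0})$. (2) $\theta[\mathsf{B}(\sigma,\rho)]\cong\overline{\mathsf{B}}(\sigma,\rho)$. (3) $\chi[\mathsf{B}(\sigma,\rho)]\cong\overline{\mathsf{B}}(\rho w_0,\sigma w_0)$. In particular, $\chi[\mathcal{P}_\alpha]\cong\mathcal{P}_{\alpha^{\mathrm r}}$ for every composition $\alpha$ of $n$.
   Context: Permutations in $\mathfrak{S}_n$ are composed as functions; $s_i=(i,i+1)$; $\ell$ is the Coxeter length; $w_0$ is the longest element of $\mathfrak{S}_n$; $\sigma^{w_0}:=w_0\sigma w_0$; $\mathrm{Des}_L(\sigma)=\{i\mid \ell(s_i\sigma)<\ell(\sigma)\}$. Left weak Bruhat order: $\sigma\preceq_L\rho$ iff $\rho=\gamma\sigma$ with $\ell(\rho)=\ell(\gamma)+\ell(\sigma)$ for some $\gamma$; $[\sigma,\rho]_L=\{\gamma\mid\sigma\preceq_L\gamma\preceq_L\rho\}$ (possibly empty). $H_n(0)$ is the unital $\mathbb{C}$-algebra generated by $\pi_1,\dots,\pi_{n-1}$ with relations $\pi_i^2=\pi_i$, $\pi_i\pi_{i+1}\pi_i=\pi_{i+1}\pi_i\pi_{i+1}$, $\pi_i\pi_j=\pi_j\pi_i$ for $|i-j|\ge2$; $\overline{\pi}_i:=\pi_i-1$; $\pi_\sigma,\overline{\pi}_\sigma$ are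 the products of the $\pi_i$, resp. $\overline{\pi}_i$, along any reduced expression of $\sigma$. $\mathsf{B}(\sigma,\rho)$ is the left $H_n(0)$-module with basis $[\sigma,\rho]_L$ and action: $\pi_i\cdot\gamma=\gamma$ if $i\in\mathrm{Des}_L(\gamma)$; $0$ if $i\notin\mathrm{Des}_L(\gamma)$ and $s_i\gamma\notin[\sigma,\rho]_L$; $s_i\gamma$ if $i\notin\mathrm{Des}_L(\gamma)$ and $s_i\gamma\in[\sigma,\rho]_L$. The negative weak Bruhat interval module $\overline{\mathsf{B}}(\sigma,\rho)$ is the left $H_n(0)$-module with basis $[\sigma,\rho]_L$ and action: $\overline{\pi}_i\star\gamma=-\gamma$ if $i\in\mathrm{Des}_L(\gamma)$; $0$ if $i\notin\mathrm{Des}_L(\gamma)$ and $s_i\gamma\notin[\sigma,\rho]_L$; $s_i\gamma$ if $i\notin\mathrm{Des}_L(\gamma)$ and $s_i\gamma\in[\sigma,\rho]_L$. $\phi,\theta$ are the algebra involutions of $H_n(0)$ with $\phi(\pi_i)=\pi_{n-i}$ and $\theta(\pi_i)=-\overline{\pi}_i$; $\chi$ is the algebra anti-involution with $\chi(\pi_i)=\pi_i$ ($1\le i\le n-1$). For an automorphism $\mu$ and a module $M$, $\mu[M]$ is the space $M$ with action $a\cdot_\mu v=\mu(a)\cdot v$. For an anti-automorphism $\nu$, $\nu[M]$ is the dual space $M^*$ with action $(a\cdot^\nu\delta)(v)=\delta(\nu(a)\cdot v)$. For a composition $\alpha=(\alpha_1,\dots,\alpha_k)$ of $n$: $\mathrm{set}(\alpha)=\{\alpha_1,\alpha_1+\alpha_2,\dots,\alpha_1+\cdots+\alpha_{k-1}\}$;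 $\alpha^{\mathrm r}=(\alpha_k,\dots,\alpha_1)$; $\alpha^{\mathrm c}$ is the composition with $\mathrm{set}(\alpha^{\mathrm c})=[n-1]\setminus\mathrm{set}(\alpha)$; $w_0(\alpha)$ is the longest element of the parabolic subgroup generated by $\{s_i\mid i\in\mathrm{set}(\alpha)\}$; $\mathcal{P}_\alpha:=H_n(0)\pi_{w_0(\alpha^{\mathrm c})}\overline{\pi}_{w_0(\alpha)}$. *)

(* Defs.v *)
From HB Require Import structures.
From mathcomp Require Import all_boot all_order all_fingroup all_algebra.
From mathcomp Require Import generic_quotient.
From mathcomp Require Import boolp functions.
From mathcomp Require Import zify.

Set Implicit Arguments.
Unset Strict Implicit.
Unset Printing Implicit Defensive.

Import GRing.Theory.

Declare Scope sym_scope.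
Delimit Scope sym_scope with sym.

(* MathComp multiplies permutations left to right, (s * t) x = t (s x); the
   product below is composition of functions, (s ∘ t) x = s (t x). *)
Definition pcomp (n : nat) (s t : 'S_n) : 'S_n := (t * s)%g.
Notation "s ∘ t" := (pcomp s t) (at level 40, left associativity) : sym_scope.
Local Open Scope sym_scope.

(* Positions, values and generators are numbered from 0: i : 'I_n.-1 stands for
   the classical index i + 1 in {1, ..., n - 1}. *)
Definition ord_lo (n : nat) (i : 'I_n.-1) : 'I_n := widen_ord (leq_pred n) i.

Fact ord_hi_subproof (n : nat) (i : 'I_n.-1) : i.+1 < n.
Proof. by case: i => i /=; rewrite ltn_predRL. Qed.

Definition ord_hi (n : nat) (i : 'I_n.-1) : 'I_n := Ordinal (ord_hi_subproof i).

Definition simple_tperm (n : nat) (i : 'I_n.-1) : 'S_n :=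
  tperm (ord_lo i) (ord_hi i).

Definition word_perm (n : nat) (w : seq 'I_n.-1) : 'S_n :=
  foldr (fun i g => simple_tperm i ∘ g) 1%g w.

Section Length.

Variable n : nat.
Implicit Types (s t g : 'S_n) (i j : 'I_n.-1) (w : seq 'I_n.-1).

Local Notation s_ := (@simple_tperm n).

Lemma pcompA s t g : s ∘ (t ∘ g) = s ∘ t ∘ g.
Proof. by rewrite /pcomp mulgA. Qed.

Lemma simple_tpermK i g : s_ i ∘ (s_ i ∘ g) = g.
Proof. by rewrite pcompA /pcomp /simple_tperm tperm2 mulg1. Qed.

Lemma pcomp1s s : 1%g ∘ s = s. Proof. exact: mulg1. Qed.
Lemma pcomps1 s : s ∘ 1%g = s. Proof. exact: mul1g. Qed.

Lemma word_perm_cat w w' : word_perm (w ++ w') = word_perm w ∘ word_perm w'.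
Proof. by elim: w => [|i w IHw] /=; rewrite ?pcomp1s // IHw pcompA. Qed.

Lemma simple_tperm_inv i g x : ((s_ i ∘ g)^-1)%g x = (g^-1)%g (s_ i x).
Proof. by rewrite /pcomp invMg permM /simple_tperm tpermV. Qed.

Let inv g : nat :=
  #|[set p : 'I_n * 'I_n | (p.1 < p.2) && ((g^-1)%g p.2 < (g^-1)%g p.1)]|.

Let desc i g : bool := (g^-1)%g (ord_hi i) < (g^-1)%g (ord_lo i).

Lemma ord_lo_neq_hi i : ord_lo i != ord_hi i.
Proof. by rewrite -val_eqE /=; lia. Qed.

Lemma simple_tperm_desc i g : desc i (s_ i ∘ g) = ~~ desc i g.
Proof.
rewrite /desc !simple_tperm_inv /simple_tperm tpermL tpermR.
have : (g^-1)%g (ord_lo i) != (g^-1)%g (ord_hi i).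
  by rewrite (inj_eq perm_inj) ord_lo_neq_hi.
by rewrite -val_eqE /=; lia.
Qed.

Lemma inv_up i g : ~~ desc i g -> inv (s_ i ∘ g) = (inv g).+1.
Proof.
move=> ndig; rewrite /inv.
pose f (p : 'I_n * 'I_n) := (s_ i p.1, s_ i p.2).
have fK : involutive f by case=> x y; rewrite /f /= /simple_tperm !tpermK.
set D := [set p | _] => /=; set E := [set p | _].
have nE : (ord_lo i, ord_hi i) \notin f @: E.
  apply/imsetP => -[[x y] + []]; rewrite inE /= => /andP[xy _] ex ey.
  have := congr1 (s_ i) ex; have := congr1 (s_ i) ey.
  rewrite /simple_tperm !tpermK tpermL tpermR => ey' ex'.
  by move: xy; rewrite -ex' -ey' /=; lia.
suff -> : D = (ord_lo i, ord_hi i) |: f @: E.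
  by rewrite cardsU1 nE add1n card_imset //; apply: inv_inj.
apply/setP => -[x y]; rewrite !inE.
have -> : ((x, y) \in f @: E) = (f (x, y) \in E).
  apply/imsetP/idP => [[p pE ->]|fE]; first by rewrite fK.
  by exists (f (x, y)) => //; rewrite fK.
rewrite inE /= !simple_tperm_inv xpair_eqE.
move: ndig; rewrite /desc -leqNgt => ndig.
have lh : (g^-1)%g (ord_lo i) != (g^-1)%g (ord_hi i).
  by rewrite (inj_eq perm_inj) ord_lo_neq_hi.
rewrite -val_eqE /= in lh.
rewrite -!(inj_eq val_inj) /=; rewrite /simple_tperm.
case: tpermP => [->|->|/eqP + /eqP]; case: tpermP => [->|->|/eqP + /eqP] //=;
  rewrite -?(inj_eq val_inj) /=; try lia.
Qed.

Lemma inv_down i g : desc i g -> inv g = (inv (s_ i ∘ g)).+1.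
Proof.
move=> dig; rewrite -[in LHS](simple_tpermK i g) inv_up //.
by rewrite simple_tperm_desc dig.
Qed.

Lemma inv1 : inv 1%g = 0.
Proof.
apply/eqP; rewrite cards_eq0; apply/eqP/setP => -[x y].
by rewrite !inE invg1 !perm1 /=; lia.
Qed.

Lemma no_desc g : (forall i, ~~ desc i g) -> g = 1%g.
Proof.
move=> nd; apply: invg_inj; rewrite invg1; set h := (g^-1)%g.
have incr (x y : 'I_n) : x.+1 = y :> nat -> h x < h y.
  move=> xy; have xn : x < n.-1 by have := ltn_ord y; lia.
  have := nd (Ordinal xn); rewrite /desc -/h.
  have -> : ord_lo (Ordinal xn) = x by apply: val_inj.
  have -> : ord_hi (Ordinal xn) = y by apply: val_inj.
  have : h x != h y by rewrite (inj_eq perm_inj) -val_eqE /=; lia.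
  by rewrite -val_eqE /=; lia.
have ge k (x : 'I_n) : x = k :> nat -> x <= h x.
  elim: k x => [|k IHk] x xk; first by rewrite xk.
  have kn : k < n by have := ltn_ord x; lia.
  by have := incr (Ordinal kn) x (esym xk); have := IHk (Ordinal kn) erefl => /=; lia.
have le_h : forall x : 'I_n, true -> x <= h x ?= iff (x == h x :> nat).
  by move=> x _; split; first exact: ge.
have [_] := leqif_sum le_h.
rewrite [X in X == _](reindex_inj (@perm_inj _ h)) eqxx => /esym/forallP hE.
by apply/permP => x; rewrite perm1; apply/val_inj/esym/eqP/(implyP (hE x)).
Qed.

Lemma inv_word g : exists2 w, word_perm w = g & size w = inv g.
Proof.
move: {2}(inv g) (erefl (inv g)) => k; elim: k g => [|k IHk] g ik.
  exists [::]; last by rewrite ik.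
  apply/esym/no_desc => i; apply/negP => dig.
  by have := inv_down dig; rewrite ik.
case: (pickP (desc^~ g)) => [i dig|nd].
  have := inv_down dig; rewrite ik => -[/esym ik'].
  by have [w wg sw] := IHk _ ik'; exists (i :: w); rewrite /= ?wg ?simple_tpermK ?sw ?ik'.
have g1 : g = 1%g by apply: no_desc => i; rewrite nd.
by move: ik; rewrite g1 inv1.
Qed.

Fact ell_subproof g : exists k, [exists w : k.-tuple 'I_n.-1, word_perm w == g].
Proof.
by have [w wg _] := inv_word g; exists (size w); apply/existsP; exists (in_tuple w); apply/eqP.
Qed.

Definition ell g : nat := ex_minn (ell_subproof g).

Definition reduced w : bool := ell (word_perm w) == size w.

Lemma ell_min w : ell (word_perm w) <= size w.
Proof.
rewrite /ell; case: ex_minnP => k _; apply.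
by apply/existsP; exists (in_tuple w); apply/eqP.
Qed.

Lemma ell_word g : exists w : (ell g).-tuple 'I_n.-1, word_perm w == g.
Proof. by rewrite /ell; case: ex_minnP => k /existsP. Qed.

Lemma inv_le_size w : inv (word_perm w) <= size w.
Proof.
elim: w => [|i w IHw] /=; first by rewrite inv1.
have [dig|ndig] := boolP (desc i (word_perm w)); last by rewrite inv_up.
by have := inv_down dig; lia.
Qed.

Lemma ellE g : ell g = inv g.
Proof.
have [w /eqP wg] := ell_word g; have [w' wg' sw'] := inv_word g.
have := inv_le_size w; have := ell_min w'; rewrite wg wg' sw' size_tuple; lia.
Qed.

Definition DesL g : {set 'I_n.-1} := [set i | ell (s_ i ∘ g) < ell g].

Lemma DesLE i g : (i \in DesL g) = desc i g.
Proof.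
rewrite inE !ellE; have [dig|ndig] := boolP (desc i g); last by rewrite inv_up //; lia.
by rewrite (inv_down dig); lia.
Qed.

(* i is a left descent of g iff i + 1 occurs to the left of i in g *)
Lemma DesLP i g : (i \in DesL g) = ((g^-1)%g (ord_hi i) < (g^-1)%g (ord_lo i)).
Proof. exact: DesLE. Qed.

Lemma DesLs i g : (i \in DesL (s_ i ∘ g)) = (i \notin DesL g).
Proof. by rewrite !DesLE simple_tperm_desc. Qed.

Lemma ell_up i g : i \notin DesL g -> ell (s_ i ∘ g) = (ell g).+1.
Proof. by rewrite !ellE DesLE; apply: inv_up. Qed.

Lemma ell_down i g : i \in DesL g -> ell g = (ell (s_ i ∘ g)).+1.
Proof. by rewrite !ellE DesLE; apply: inv_down. Qed.

Lemma ell_comp s t : ell (s ∘ t) <= ell s + ell t.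
Proof.
have [u /eqP us] := ell_word s; have [v /eqP vt] := ell_word t.
by have := ell_min (u ++ v); rewrite word_perm_cat us vt size_cat !size_tuple.
Qed.

Lemma ell1 : ell 1%g = 0. Proof. by rewrite ellE inv1. Qed.

Lemma ell_simple i : ell (s_ i) = 1.
Proof.
rewrite -[s_ i]pcomps1 ell_up ?ell1 // inE ell1; lia.
Qed.

Lemma ell_eq0 g : ell g = 0 -> g = 1%g.
Proof.
move=> g0; apply: no_desc => i; rewrite -DesLE; apply/negP => /ell_down; lia.
Qed.

Lemma simple_adj i j : i.+1 = j :> nat ->
  [/\ ord_lo j = ord_hi i, s_ i (ord_hi j) = ord_hi j & s_ j (ord_lo i) = ord_lo i].
Proof.
move=> ij; split; first exact: val_inj.
  by rewrite /simple_tperm tpermD // -val_eqE /=; lia.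
by rewrite /simple_tperm tpermD // -val_eqE /=; lia.
Qed.

Lemma simple_braid i j g : i.+1 = j :> nat ->
  s_ i ∘ (s_ j ∘ (s_ i ∘ g)) = s_ j ∘ (s_ i ∘ (s_ j ∘ g)).
Proof.
move=> ij; rewrite !pcompA; congr (_ ∘ _).
have [loj hij loi] := simple_adj ij.
have sis : (s_ i)^-1%g = s_ i by rewrite /simple_tperm tpermV.
have sjs : (s_ j)^-1%g = s_ j by rewrite /simple_tperm tpermV.
have -> : s_ i ∘ s_ j ∘ s_ i = (s_ j ^ s_ i)%g by rewrite /pcomp conjgE sis mulgA.
have -> : s_ j ∘ s_ i ∘ s_ j = (s_ i ^ s_ j)%g by rewrite /pcomp conjgE sjs mulgA.
rewrite {1}[s_ j]/simple_tperm {2}[s_ i]/simple_tperm !tpermJ hij loi loj.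
by rewrite {1}/simple_tperm tpermR -loj /simple_tperm tpermL.
Qed.

Lemma simple_far i j : i.+1 < j ->
  [/\ s_ i (ord_lo j) = ord_lo j, s_ i (ord_hi j) = ord_hi j,
      s_ j (ord_lo i) = ord_lo i & s_ j (ord_hi i) = ord_hi i].
Proof.
by move=> ij; split; rewrite /simple_tperm tpermD // -val_eqE /=; lia.
Qed.

Lemma simple_commute i j g : i.+1 < j -> s_ i ∘ (s_ j ∘ g) = s_ j ∘ (s_ i ∘ g).
Proof.
move=> ij; rewrite !pcompA; congr (_ ∘ _); have [_ _ lo hi] := simple_far ij.
have e : (s_ i ^ s_ j)%g = s_ i by rewrite {1}/simple_tperm tpermJ lo hi.
by rewrite /pcomp [RHS]conjgC e.
Qed.

(* The word problem: a product along a reduced word only depends on the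
   permutation, for any family satisfying the braid relations. *)
Lemma matsumoto (S : pzRingType) (f : 'I_n.-1 -> S) :
    (forall i j, i.+1 = j :> nat -> f i * f j * f i = f j * f i * f j)%R ->
    (forall i j, (i.+1 < j)%N -> f i * f j = f j * f i)%R ->
  forall u v, reduced u -> reduced v -> word_perm u = word_perm v ->
  (\prod_(i <- u) f i = \prod_(i <- v) f i)%R.
Proof.
move=> fB fC u; move: {2}(size u) (leqnn (size u)) => k.
elim: k u => [|k IHk] [|i u] //.
  move=> _ [|j v] // _ /eqP rv e; move: rv; rewrite -e /= ell1; lia.
  by move=> _ [|j v] // _ /eqP rv e; move: rv; rewrite -e /= ell1; lia.
rewrite /= ltnS => su [|j v] ru rv e.
  by move: ru; rewrite /reduced /= e /= ell1.
have red_tl l w : reduced (l :: w) ->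
    [/\ reduced w, l \in DesL (word_perm (l :: w)) & word_perm w = s_ l ∘ word_perm (l :: w)].
  move=> /eqP r; have r' := ell_min w; rewrite /reduced /= in r *.
  rewrite simple_tpermK; have [|nd] := boolP (l \in DesL (s_ l ∘ word_perm w)).
    by move=> /ell_down; rewrite simple_tpermK r => -[<-]; split.
  by have := ell_up nd; rewrite simple_tpermK r; lia.
have [ru' iD uE] := red_tl _ _ ru; have [rv' jD vE] := red_tl _ _ rv.
set g := word_perm (i :: u) in iD uE.
have {}e : g = word_perm (j :: v) by [].
rewrite -e in jD vE.
have sg : ell g = (size u).+1 by apply/eqP.
have sv : size v = size u by move/eqP: rv; rewrite -e -/g sg => -[].
rewrite !big_cons; clearbody g.
have red_word h : exists2 w, word_perm w = h & reduced w.
  have [w /eqP wh] := ell_word h; exists w => //.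
  by rewrite /reduced wh size_tuple.
have far (l m : 'I_n.-1) ul vm : l.+1 < m -> l \in DesL g -> m \in DesL g ->
    reduced ul -> reduced vm -> size ul <= k -> size vm <= k ->
    word_perm ul = s_ l ∘ g -> word_perm vm = s_ m ∘ g ->
  (f l * \prod_(x <- ul) f x = f m * \prod_(x <- vm) f x)%R.
  move=> lm lD mD rul rvm sul svm ulE vmE.
  have [loi hii loj hij] := simple_far lm.
  have mD' : m \in DesL (s_ l ∘ g) by rewrite DesLP !simple_tperm_inv loi hii -DesLP.
  have lD' : l \in DesL (s_ m ∘ g) by rewrite DesLP !simple_tperm_inv loj hij -DesLP.
  have [t tE rt] := red_word (s_ m ∘ (s_ l ∘ g)).
  have st : (size t).+2 = ell g.
    by move/eqP: rt; rewrite tE (ell_down lD) (ell_down mD') => ->.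
  have r1 : reduced (m :: t).
    by rewrite /reduced /= tE simple_tpermK -eqSS -(ell_down lD) st.
  have r2 : reduced (l :: t).
    rewrite /reduced /= tE -(simple_commute _ lm) simple_tpermK.
    by rewrite -eqSS -(ell_down mD) st.
  rewrite (IHk ul sul (m :: t)) //; last by rewrite /= tE simple_tpermK.
  rewrite (IHk vm svm (l :: t)) //; last by rewrite /= tE -(simple_commute _ lm) simple_tpermK.
  by rewrite !big_cons !mulrA fC.
have near (l m : 'I_n.-1) ul vm : l.+1 = m :> nat -> l \in DesL g -> m \in DesL g ->
    reduced ul -> reduced vm -> size ul <= k -> size vm <= k ->
    word_perm ul = s_ l ∘ g -> word_perm vm = s_ m ∘ g ->
  (f l * \prod_(x <- ul) f x = f m * \prod_(x <- vm) f x)%R.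
  move=> lm lD mD rul rvm sul svm ulE vmE.
  have [lom him lol] := simple_adj lm.
  have sl1 : s_ l (ord_lo l) = ord_hi l by exact: tpermL.
  have sl2 : s_ l (ord_hi l) = ord_lo l by exact: tpermR.
  have sm1 : s_ m (ord_hi l) = ord_hi m by rewrite -lom; exact: tpermL.
  have sm2 : s_ m (ord_hi m) = ord_hi l by rewrite -lom; exact: tpermR.
  have ev := (simple_tperm_inv, lom, him, lol, sl1, sl2, sm1, sm2).
  have lD1 := lD; have mD1 := mD; rewrite !DesLP ?lom in lD1 mD1.
  have mlD : m \in DesL (s_ l ∘ g) by rewrite DesLP !ev (ltn_trans mD1 lD1).
  have lmlD : l \in DesL (s_ m ∘ (s_ l ∘ g)) by rewrite DesLP !ev mD1.
  have [t tE rt] := red_word (s_ l ∘ (s_ m ∘ (s_ l ∘ g))).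
  have st : (size t).+3 = ell g.
    by move/eqP: rt; rewrite tE (ell_down lD) (ell_down mlD) (ell_down lmlD) => ->.
  have e1 : word_perm (m :: l :: t) = s_ l ∘ g by rewrite /= tE !simple_tpermK.
  have e2 : word_perm (l :: m :: t) = s_ m ∘ g.
    by rewrite /= tE simple_braid // !simple_tpermK.
  have r1 : reduced (m :: l :: t).
    by rewrite /reduced e1 /= -eqSS -(ell_down lD) st.
  have r2 : reduced (l :: m :: t).
    by rewrite /reduced e2 /= -eqSS -(ell_down mD) st.
  rewrite (IHk ul sul (m :: l :: t)) ?e1 //.
  rewrite (IHk vm svm (l :: m :: t)) ?e2 //.
  by rewrite !big_cons !mulrA fB.
have [ij|ji|ij] := ltngtP i j; last first.
- have ij' : i = j by apply: val_inj.
  rewrite -ij' in vE *; congr (_ * _)%R; apply: IHk => //.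
  by rewrite uE vE.
- have sv' : size v <= k by rewrite sv.
  have [ji'|ji'] := eqVneq j.+1 (i : nat).
    exact: esym (near _ _ _ _ ji' jD iD rv' ru' sv' su vE uE).
  have ji2 : j.+1 < i by rewrite ltn_neqAle ji'.
  exact: esym (far _ _ _ _ ji2 jD iD rv' ru' sv' su vE uE).
- have sv' : size v <= k by rewrite sv.
  have [ij'|ij'] := eqVneq i.+1 (j : nat).
    exact: near _ _ _ _ ij' iD jD ru' rv' su sv' uE vE.
  have ij2 : i.+1 < j by rewrite ltn_neqAle ij'.
  exact: far _ _ _ _ ij2 iD jD ru' rv' su sv' uE vE.
Qed.

End Length.

Section WeakOrder.

Variable n : nat.
Implicit Types (g s t r : 'S_n) (i j : 'I_n.-1).

Local Notation s_ := (@simple_tperm n).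

Definition leL s r : bool :=
  [exists g, (r == g ∘ s) && (ell r == ell g + ell s)].

Definition weak_interval s r : {set 'S_n} := [set g | leL s g && leL g r].

Definition longest : 'S_n := [arg max_(w > 1%g) ell w].

Definition conj_longest s : 'S_n := longest ∘ s ∘ longest.

Definition parabolic_longest (S : {set 'I_n.-1}) : 'S_n :=
  [arg max_(w > 1%g in <<[set s_ i | i in S]>>%g) ell w].

Definition reduced_word g : seq 'I_n.-1 := xchoose (ell_word g).

Lemma word_perm_reduced_word g : word_perm (reduced_word g) = g.
Proof. exact/eqP/(xchooseP (ell_word g)). Qed.

Lemma reduced_reduced_word g : reduced (reduced_word g).
Proof. by rewrite /reduced word_perm_reduced_word size_tuple. Qed.

Lemma leL_trans g s t : leL s g -> leL g t -> leL s t.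
Proof.
move=> /existsP[a /andP[/eqP ga /eqP la]] /existsP[b /andP[/eqP tb /eqP lb]].
apply/existsP; exists (b ∘ a); rewrite -pcompA -ga -tb eqxx /=.
have := ell_comp b a; have := ell_comp (b ∘ a) s; rewrite -pcompA -ga -tb.
move: (ell t) (ell b) (ell g) (ell (b ∘ a)) (ell a) (ell s) lb la; lia.
Qed.

Definition hecke_step i g : 'S_n := if i \in DesL g then g else s_ i ∘ g.

Lemma leL_step i g : leL g (hecke_step i g).
Proof.
rewrite /hecke_step; case: ifPn => iD; apply/existsP.
  by exists 1%g; rewrite pcomp1s ell1 !eqxx.
by exists (s_ i); rewrite ell_simple ell_up ?eqxx.
Qed.

Lemma hecke_step_idem i g : hecke_step i (hecke_step i g) = hecke_step i g.
Proof.
rewrite {2 3}/hecke_step; case: ifPn => iD; rewrite /hecke_step ?iD //.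
by rewrite DesLs iD.
Qed.

Lemma hecke_step_comm i j g : i.+1 < j ->
  hecke_step i (hecke_step j g) = hecke_step j (hecke_step i g).
Proof.
move=> ij; have [loi hii loj hij] := simple_far ij.
have Dj : (j \in DesL (s_ i ∘ g)) = (j \in DesL g).
  by rewrite !DesLP !simple_tperm_inv loi hii.
have Di : (i \in DesL (s_ j ∘ g)) = (i \in DesL g).
  by rewrite !DesLP !simple_tperm_inv loj hij.
rewrite /hecke_step; case iD: (i \in DesL g); case jD: (j \in DesL g);
  rewrite ?Di ?Dj ?iD ?jD; by [|exact: simple_commute].
Qed.

Lemma step_braid_abstract (T : Type) (a b : T -> T) (P Q : T -> bool) (g : T) (C : bool) :
    P (a g) = ~~ P g -> Q (b g) = ~~ Q g ->
    Q (a g) = C -> P (b g) = C -> P (b (a g)) = Q g -> Q (a (b g)) = P g ->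
    (P g -> Q g -> C) -> (~~ P g -> ~~ Q g -> C = false) ->
    a (b (a g)) = b (a (b g)) ->
  let ma h := if P h then h else a h in
  let mb h := if Q h then h else b h in
  ma (mb (ma g)) = mb (ma (mb g)).
Proof.
move=> Pa Qb Qa Pb Pba Qab DC nDC br /=.
case Pg: (P g) Pa Qab DC nDC; case Qg: (Q g) Qb Pba => Qb Pba Pa Qab DC nDC;
  case: C Qa Pb DC nDC => Qa Pb DC nDC;
  rewrite ?(Pg, Qg, Pa, Qb, Qa, Pb, Pba, Qab) //;
  rewrite ?(Pg, Qg, Pa, Qb, Qa, Pb, Pba, Qab) //;
  rewrite ?(Pg, Qg, Pa, Qb, Qa, Pb, Pba, Qab) //.
all: by first [have := DC isT isT | have := nDC isT isT].
Qed.

Lemma hecke_step_braid i j g : i.+1 = j :> nat ->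
  hecke_step i (hecke_step j (hecke_step i g)) =
  hecke_step j (hecke_step i (hecke_step j g)).
Proof.
move=> ij; have [loj hij loi] := simple_adj ij.
have si1 : s_ i (ord_lo i) = ord_hi i by exact: tpermL.
have si2 : s_ i (ord_hi i) = ord_lo i by exact: tpermR.
have sj1 : s_ j (ord_hi i) = ord_hi j by rewrite -loj; exact: tpermL.
have sj2 : s_ j (ord_hi j) = ord_hi i by rewrite -loj; exact: tpermR.
have ev := (simple_tperm_inv, loj, hij, loi, si1, si2, sj1, sj2).
set C := (g^-1)%g (ord_hi j) < (g^-1)%g (ord_lo i).
have Dji : (j \in DesL (s_ i ∘ g)) = C by rewrite DesLP !ev.
have Dij : (i \in DesL (s_ j ∘ g)) = C by rewrite DesLP !ev.
have Diji : (i \in DesL (s_ j ∘ (s_ i ∘ g))) = (j \in DesL g).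
  by rewrite [RHS]DesLP DesLP !ev.
have Djij : (j \in DesL (s_ i ∘ (s_ j ∘ g))) = (i \in DesL g).
  by rewrite [RHS]DesLP DesLP !ev.
have DC : i \in DesL g -> j \in DesL g -> C.
  by rewrite !DesLP loj => yx zy; apply: ltn_trans zy yx.
have nDC : i \notin DesL g -> j \notin DesL g -> C = false.
  rewrite !DesLP loj -!leqNgt => xy yz.
  by apply/negbTE; rewrite -leqNgt (leq_trans xy yz).
exact: (@step_braid_abstract _ (pcomp (s_ i)) (pcomp (s_ j))
          (fun h => i \in DesL h) (fun h => j \in DesL h) g C (DesLs i g) (DesLs j g) Dji Dij Diji Djij DC nDC
          (simple_braid g ij)).
Qed.

End WeakOrder.

(* An index i : 'I_n.-1 stands for i + 1, so the last partial sum, n, is never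
   in the set. *)
Record composition (n : nat) := Composition {
  cparts : seq nat;
  cpartsP : all (ltn 0) cparts && (sumn cparts == n)
}.

Section Compositions.

Variable n : nat.
Implicit Types (a : composition n) (S : {set 'I_n.-1}).

Definition comp_set a : {set 'I_n.-1} :=
  [set i : 'I_n.-1 | i.+1 \in scanl addn 0 (cparts a)].

Fact comp_rev_subproof a :
  all (ltn 0) (rev (cparts a)) && (sumn (rev (cparts a)) == n).
Proof. by rewrite all_rev sumn_rev cpartsP. Qed.

Definition comp_rev a : composition n := Composition (comp_rev_subproof a).

Definition cuts S : seq nat :=
  [seq k <- iota 1 n | (k == n) || [exists i in S, i.+1 == k]].

(* differences of consecutive elements of 0 :: cuts S; see comp_of_setK *)
Definition parts_of_set S : seq nat := pairmap (fun x y => y - x) 0 (cuts S).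

Lemma cuts_pos S : path ltn 0 (cuts S).
Proof.
suff: sorted ltn (0 :: cuts S) by [].
have -> : 0 :: cuts S = [seq k <- iota 0 n.+1 | (k == 0) || ((k == n) || [exists i in S, i.+1 == k])].
  rewrite /=; congr (_ :: _); apply: eq_in_filter => k.
  by rewrite mem_iota => /andP[k0 _]; rewrite (gtn_eqF k0).
by apply: sorted_filter; [exact: ltn_trans | exact: iota_ltn_sorted].
Qed.

Lemma cuts_path S : path leq 0 (cuts S).
Proof. by apply: sub_path (cuts_pos S) => x y /ltnW. Qed.

Lemma scanl_pairmap_sub x s : path leq x s ->
  scanl addn x (pairmap (fun x y => y - x) x s) = s.
Proof. by elim: s x => //= y s IHs x /andP[xy ys]; rewrite subnKC // IHs. Qed.

Lemma sumn_scanl x s : x + sumn s = last x (scanl addn x s).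
Proof. by elim: s x => [|y s IHs] x /=; rewrite ?addn0 // addnA IHs. Qed.

Lemma cuts_last S : last 0 (cuts S) = n.
Proof.
rewrite /cuts; have [n0|n0] := posnP n.
  by have -> : iota 1 n = [::] by rewrite n0.
have -> : iota 1 n = iota 1 n.-1 ++ [:: n].
  by rewrite -[in LHS](prednK n0) -[n.-1.+1]addn1 iotaD add1n prednK.
by rewrite filter_cat last_cat /= eqxx.
Qed.

Lemma pairmap_pos x s : path ltn x s ->
  all (ltn 0) (pairmap (fun x y => y - x) x s).
Proof.
by elim: s x => //= y s IHs x /andP[xy ys]; rewrite subn_gt0 xy IHs.
Qed.

Fact comp_of_set_subproof S :
  all (ltn 0) (parts_of_set S) && (sumn (parts_of_set S) == n).
Proof.
rewrite /parts_of_set pairmap_pos ?cuts_pos //=.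
by rewrite -[sumn _]add0n sumn_scanl scanl_pairmap_sub ?cuts_path // cuts_last.
Qed.

Definition comp_of_set S : composition n := Composition (comp_of_set_subproof S).

Lemma comp_of_setK S : comp_set (comp_of_set S) = S.
Proof.
apply/setP => i; rewrite inE /= scanl_pairmap_sub ?cuts_path //.
rewrite mem_filter mem_iota; have := ltn_ord i; rewrite ltn_predRL => iltn.
rewrite (ltn_eqF iltn) /= add1n ltnS (ltnW iltn) andbT.
apply/exists_inP/idP => [[j jS /eqP[ji]]|iS]; last by exists i.
by rewrite -(val_inj ji).
Qed.

Definition comp_compl a : composition n := comp_of_set (~: comp_set a).

Lemma comp_set_compl a : comp_set (comp_compl a) = ~: comp_set a.
Proof. exact: comp_of_setK. Qed.

End Compositions.

Local Open Scope ring_scope.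
Local Open Scope quotient_scope.

(* The 0-Hecke algebra is built from its presentation: formal expressions in
   constants and generators, modulo the least congruence that contains the
   axioms of unital associative K-algebras and the defining relations. *)
Inductive hexpr (K : Type) (n : nat) : Type :=
  | HConst of K
  | HGen of 'I_n.-1
  | HAdd of hexpr K n & hexpr K n
  | HMul of hexpr K n & hexpr K n.

HB.instance Definition _ (K : Type) (n : nat) := gen_eqMixin (hexpr K n).
HB.instance Definition _ (K : Type) (n : nat) := gen_choiceMixin (hexpr K n).

Inductive hcong (K : fieldType) (n : nat) : hexpr K n -> hexpr K n -> Prop :=
  | hcong_refl x : hcong x x
  | hcong_sym x y : hcong x y -> hcong y x
  | hcong_trans x y z : hcong x y -> hcong y z -> hcong x z
  | hcong_add x x' y y' : hcong x x' -> hcong y y' -> hcong (HAdd x y) (HAdd x' y')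
  | hcong_mul x x' y y' : hcong x x' -> hcong y y' -> hcong (HMul x y) (HMul x' y')
  | hcong_addA x y z : hcong (HAdd x (HAdd y z)) (HAdd (HAdd x y) z)
  | hcong_addC x y : hcong (HAdd x y) (HAdd y x)
  | hcong_add0 x : hcong (HAdd (HConst n 0) x) x
  | hcong_mulA x y z : hcong (HMul x (HMul y z)) (HMul (HMul x y) z)
  | hcong_mul1 x : hcong (HMul (HConst n 1) x) x
  | hcong_mulDl x y z : hcong (HMul (HAdd x y) z) (HAdd (HMul x z) (HMul y z))
  | hcong_mulDr x y z : hcong (HMul x (HAdd y z)) (HAdd (HMul x y) (HMul x z))
  | hcong_constD a b : hcong (HConst n (a + b)) (HAdd (HConst n a) (HConst n b))
  | hcong_constM a b : hcong (HConst n (a * b)) (HMul (HConst n a) (HConst n b))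
  | hcong_constC a x : hcong (HMul (HConst n a) x) (HMul x (HConst n a))
  | hcong_mul0 x : hcong (HMul (HConst n 0) x) (HConst n 0)
  | hcong_idem i : hcong (HMul (HGen K i) (HGen K i)) (HGen K i)
  | hcong_braid (i j : 'I_n.-1) : i.+1 = j :> nat ->
      hcong (HMul (HMul (HGen K i) (HGen K j)) (HGen K i))
            (HMul (HMul (HGen K j) (HGen K i)) (HGen K j))
  | hcong_comm (i j : 'I_n.-1) : (i.+1 < j)%N ->
      hcong (HMul (HGen K i) (HGen K j)) (HMul (HGen K j) (HGen K i)).

Definition hcongb (K : fieldType) (n : nat) : rel (hexpr K n) :=
  fun x y => `[< hcong x y >].

Fact hcongb_equiv (K : fieldType) (n : nat) : equiv_class_of (@hcongb K n).
Proof.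
split=> [x|x y|y x z]; first exact/asboolP/hcong_refl.
  by apply/asboolP/asboolP; apply: hcong_sym.
by move=> /asboolP xy /asboolP yz; apply/asboolP/(hcong_trans xy yz).
Qed.

Canonical hcongb_equiv_rel (K : fieldType) (n : nat) :=
  EquivRelPack (hcongb_equiv K n).

Definition hecke (K : fieldType) (n : nat) : Type := {eq_quot @hcongb K n}.

HB.instance Definition _ (K : fieldType) (n : nat) := Choice.on (hecke K n).
HB.instance Definition _ (K : fieldType) (n : nat) :=
  EqQuotient.on (hecke K n).

Record hecke_relations (n : nat) (S : pzRingType) (f : 'I_n.-1 -> S) : Prop :=
  HeckeRelations {
    hecke_rel_idem : forall i, f i * f i = f i;
    hecke_rel_braid : forall i j : 'I_n.-1, i.+1 = j :> nat ->
      f i * f j * f i = f j * f i * f j;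
    hecke_rel_comm : forall i j : 'I_n.-1, (i.+1 < j)%N -> f i * f j = f j * f i
  }.

(* c is meant to be a ring morphism with central image *)
Fixpoint heval (K : fieldType) (n : nat) (S : pzRingType) (c : K -> S)
    (f : 'I_n.-1 -> S) (x : hexpr K n) : S :=
  match x with
  | HConst a => c a
  | HGen i => f i
  | HAdd x y => heval c f x + heval c f y
  | HMul x y => heval c f x * heval c f y
  end.

Lemma heval_cong (K : fieldType) (n : nat) (S : pzRingType)
    (c : {rmorphism K -> S}) (f : 'I_n.-1 -> S) :
    (forall a x, c a * x = x * c a) -> hecke_relations f ->
  forall x y : hexpr K n, hcong x y -> heval c f x = heval c f y.
Proof.
move=> cC [fI fB fC] x y; elim=> {x y} //=.
- by move=> x y z _ -> _ ->.
- by move=> x x' y y' _ -> _ ->.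
- by move=> x x' y y' _ -> _ ->.
- by move=> x y z; rewrite addrA.
- by move=> x y; rewrite addrC.
- by move=> x; rewrite rmorph0 add0r.
- by move=> x y z; rewrite mulrA.
- by move=> x; rewrite rmorph1 mul1r.
- by move=> x y z; rewrite mulrDl.
- by move=> x y z; rewrite mulrDr.
- by move=> a b; rewrite rmorphD.
- by move=> a b; rewrite rmorphM.
- by move=> x; rewrite rmorph0 mul0r.
Qed.

Section HeckeAlgebra.

Variables (K : fieldType) (n : nat).
Local Notation H := (hecke K n).
Implicit Types (x y z : H) (a b : K) (i j : 'I_n.-1).

Definition hclass (t : hexpr K n) : H := \pi_(hecke K n) t.

Lemma hclassP s t : hcong s t -> hclass s = hclass t.
Proof. by move=> st; apply/eqmodP/asboolP. Qed.

Lemma hclass_cong s t : hclass s = hclass t -> hcong s t.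
Proof. by move=> /eqmodP/asboolP. Qed.

Lemma hclass_ind (P : H -> Prop) : (forall t, P (hclass t)) -> forall x, P x.
Proof. by move=> PH; elim/quotW. Qed.

Definition hconst a : H := hclass (HConst n a).
Definition hpi i : H := hclass (HGen K i).
Definition hadd x y : H := hclass (HAdd (repr x) (repr y)).
Definition hmul x y : H := hclass (HMul (repr x) (repr y)).
Definition hopp x : H := hmul (hconst (-1)) x.

Lemma hrepr t : hcong (repr (hclass t)) t.
Proof. by apply: hclass_cong; rewrite /hclass reprK. Qed.

Lemma haddE s t : hadd (hclass s) (hclass t) = hclass (HAdd s t).
Proof. by apply: hclassP; apply: hcong_add; apply: hrepr. Qed.

Lemma hmulE s t : hmul (hclass s) (hclass t) = hclass (HMul s t).
Proof. by apply: hclassP; apply: hcong_mul; apply: hrepr. Qed.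

Fact haddA : associative hadd.
Proof.
elim/hclass_ind=> x; elim/hclass_ind=> y; elim/hclass_ind=> z.
by rewrite !haddE; apply/hclassP/hcong_addA.
Qed.

Fact haddC : commutative hadd.
Proof.
elim/hclass_ind=> x; elim/hclass_ind=> y; rewrite !haddE.
exact/hclassP/hcong_addC.
Qed.

Fact hadd0 : left_id (hconst 0) hadd.
Proof. by elim/hclass_ind=> x; rewrite haddE; apply/hclassP/hcong_add0. Qed.

Fact hmulA : associative hmul.
Proof.
elim/hclass_ind=> x; elim/hclass_ind=> y; elim/hclass_ind=> z.
by rewrite !hmulE; apply/hclassP/hcong_mulA.
Qed.

Fact hmul1 : left_id (hconst 1) hmul.
Proof. by elim/hclass_ind=> x; rewrite hmulE; apply/hclassP/hcong_mul1. Qed.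

Fact hconstC a x : hmul (hconst a) x = hmul x (hconst a).
Proof. by elim/hclass_ind: x => x; rewrite !hmulE; apply/hclassP/hcong_constC. Qed.

Fact hmul1r : right_id (hconst 1) hmul.
Proof. by move=> x; rewrite -hconstC hmul1. Qed.

Fact hmulDl : left_distributive hmul hadd.
Proof.
elim/hclass_ind=> x; elim/hclass_ind=> y; elim/hclass_ind=> z.
by rewrite !(hmulE, haddE); apply/hclassP/hcong_mulDl.
Qed.

Fact hmulDr : right_distributive hmul hadd.
Proof.
elim/hclass_ind=> x; elim/hclass_ind=> y; elim/hclass_ind=> z.
by rewrite !(hmulE, haddE); apply/hclassP/hcong_mulDr.
Qed.

Fact hconstD a b : hconst (a + b) = hadd (hconst a) (hconst b).
Proof. by rewrite haddE; apply/hclassP/hcong_constD. Qed.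

Fact hconstM a b : hconst (a * b) = hmul (hconst a) (hconst b).
Proof. by rewrite hmulE; apply/hclassP/hcong_constM. Qed.

Fact hmul0 : left_zero (hconst 0) hmul.
Proof. by elim/hclass_ind=> x; rewrite hmulE; apply/hclassP/hcong_mul0. Qed.

Fact hmulr0 : right_zero (hconst 0) hmul.
Proof. by move=> x; rewrite -hconstC hmul0. Qed.

Fact haddN : left_inverse (hconst 0) hopp hadd.
Proof.
by move=> x; rewrite /hopp -{2}[x]hmul1 -hmulDl -hconstD addNr hmul0.
Qed.

HB.instance Definition _ := GRing.isZmodule.Build H haddA haddC hadd0 haddN.
HB.instance Definition _ := GRing.Zmodule_isPzRing.Build H
  hmulA hmul1 hmul1r hmulDl hmulDr.

Fact heval_relations1 : hecke_relations (fun _ : 'I_n.-1 => 1 : K).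
Proof. by split=> *; rewrite ?mulr1. Qed.

Fact hone_neq0 : 1 != 0 :> H.
Proof.
apply/eqP => /hclass_cong.
move=> /(heval_cong (c := @idfun K) (@mulrC K) heval_relations1) /=.
by apply/eqP; rewrite oner_eq0.
Qed.

HB.instance Definition _ := GRing.PzSemiRing_isNonZero.Build H hone_neq0.

Definition hscale a x : H := hconst a * x.

Fact hscaleA a b x : hscale a (hscale b x) = hscale (a * b) x.
Proof. by rewrite /hscale mulrA; congr (_ * _); rewrite hconstM. Qed.

Fact hscale1 : left_id 1 hscale.
Proof. by move=> x; apply: hmul1. Qed.

Fact hscaleDr : right_distributive hscale +%R.
Proof. by move=> a x y; rewrite /hscale mulrDr. Qed.

Fact hscaleDl x : {morph hscale^~ x : a b / a + b}.
Proof. by move=> a b; rewrite /hscale -mulrDl; congr (_ * _); apply: hconstD. Qed.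

HB.instance Definition _ := GRing.Zmodule_isLmodule.Build K H
  hscaleA hscale1 hscaleDr hscaleDl.

Fact hscaleAl a x y : a *: (x * y) = (a *: x) * y.
Proof. by rewrite /GRing.scale /= /hscale mulrA. Qed.

HB.instance Definition _ := GRing.Lmodule_isLalgebra.Build K H hscaleAl.

Fact hscaleAr a x y : a *: (x * y) = x * (a *: y).
Proof.
rewrite /GRing.scale /= /hscale !mulrA; congr (_ * _); exact: hconstC.
Qed.

HB.instance Definition _ := GRing.Lalgebra_isAlgebra.Build K H hscaleAr.

Lemma hconstE a : hconst a = a%:A.
Proof. by rewrite /GRing.scale /= /hscale mulr1. Qed.

Lemma hpi_relations : hecke_relations hpi.
Proof.
split=> [i|i j ij|i j ij]; rewrite /hpi /GRing.mul /= !hmulE; apply: hclassP.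
- exact: hcong_idem.
- exact: hcong_braid.
- exact: hcong_comm.
Qed.

Lemma hecke_ind (P : H -> Prop) :
    (forall a, P a%:A) -> (forall i, P (hpi i)) ->
    (forall x y, P x -> P y -> P (x + y)) ->
    (forall x y, P x -> P y -> P (x * y)) ->
  forall x, P x.
Proof.
move=> Pc Pg Pa Pm; elim/hclass_ind; elim=> [a|i|x Px y Py|x Px y Py] //.
- by rewrite -[hclass _]/(hconst a) hconstE.
- exact: Pg.
- by rewrite -haddE; apply: Pa.
- by rewrite -hmulE; apply: Pm.
Qed.

Definition hlift (S : pzRingType) (c : {rmorphism K -> S})
    (cC : forall a (s : S), c a * s = s * c a)
    (f : 'I_n.-1 -> S) (ff : hecke_relations f) (x : H) : S :=
  heval c f (repr x).

Section Lift.

Variables (S : pzRingType) (c : {rmorphism K -> S}).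
Variables (cC : forall a (s : S), c a * s = s * c a).
Variables (f : 'I_n.-1 -> S) (ff : hecke_relations f).
Local Notation L := (hlift cC ff).

Lemma hlift_class t : L (hclass t) = heval c f t.
Proof. exact: heval_cong (hrepr t). Qed.

Lemma hlift_pi i : L (hpi i) = f i. Proof. exact: hlift_class. Qed.

Lemma hlift_alg a : L a%:A = c a.
Proof. by rewrite -hconstE hlift_class. Qed.

Fact hlift_is_zmod_morphism : zmod_morphism L.
Proof.
elim/hclass_ind=> x; elim/hclass_ind=> y.
rewrite /GRing.opp /= /hopp /GRing.add /= hmulE haddE !hlift_class /=.
by rewrite rmorphN1 mulN1r.
Qed.

Fact hlift_is_monoid_morphism : monoid_morphism L.
Proof.
split; first by rewrite -(rmorph1 c) -hlift_alg scale1r.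
elim/hclass_ind=> x; elim/hclass_ind=> y.
by rewrite /GRing.mul /= hmulE !hlift_class.
Qed.

HB.instance Definition _ := GRing.isZmodMorphism.Build H S L hlift_is_zmod_morphism.
HB.instance Definition _ :=
  GRing.isMonoidMorphism.Build H S L hlift_is_monoid_morphism.

End Lift.

End HeckeAlgebra.

Section HeckeRelations.

Variables (n : nat) (S : pzRingType) (f : 'I_n.-1 -> S).
Hypothesis ff : hecke_relations f.

Let sandwich (a b : S) : a * a = a ->
  (1 - a) * (1 - b) * (1 - a) = 1 - b + a * b - a + b * a - a * b * a.
Proof.
move=> aa; rewrite mulrBr mulr1 mulrBl mul1r mulrBr mulr1.
have -> : (1 - b - (a - a * b)) * a = a * b * a - b * a.
  by rewrite mulrBl mulrBl mul1r mulrBl aa opprB addrC addrA subrK.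
by rewrite !opprB !addrA.
Qed.

Lemma hecke_relations_sub1 : hecke_relations (fun i => 1 - f i).
Proof.
have [I B C] := ff; split=> [i|i j ij|i j ij].
- by rewrite mulrBr mulr1 mulrBl mul1r I subrr subr0.
- rewrite !sandwich // B //.
  by rewrite [LHS](ACl (1*4*5*2*3*6))%AC.
- rewrite mulrBl mul1r mulrBr mulr1 mulrBl mul1r mulrBr mulr1 C //.
  by rewrite !opprB !addrA [LHS](ACl (1*4*3*2))%AC.
Qed.

Lemma hecke_relations_rev : hecke_relations (fun i => f (rev_ord i)).
Proof.
have [I B C] := ff; split=> [i|i j ij|i j ij]; first exact: I.
  by apply/esym/B => /=; have := ltn_ord j; lia.
by apply/esym/C => /=; have := ltn_ord j; lia.
Qed.

Lemma hecke_relations_conv : hecke_relations (f : 'I_n.-1 -> S^c).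
Proof.
have [I B C] := ff; split=> [i|i j ij|i j ij]; first exact: I.
  by have := B i j ij; rewrite -2!(@mulrA S); apply.
exact: esym (C i j ij).
Qed.

End HeckeRelations.

Section Algebra.

Variables (K : fieldType) (n : nat).
Local Notation H := (hecke K n).
Implicit Types (x y : H) (a : K) (i j : 'I_n.-1).

Local Notation pi := (@hpi K n).

Definition hbarpi i : H := pi i - 1.

(* products along a reduced word; by hpi_perm_word and hbarpi_perm_word they do
   not depend on the word chosen *)
Definition hpi_perm (g : 'S_n) : H := \prod_(i <- reduced_word g) pi i.
Definition hbarpi_perm (g : 'S_n) : H := \prod_(i <- reduced_word g) hbarpi i.

Lemma hpi_perm_word w : reduced w -> hpi_perm (word_perm w) = \prod_(i <- w) pi i.
Proof.
have [_ B C] := hpi_relations K n.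
move=> rw; apply: (matsumoto B C) => //; first exact: reduced_reduced_word.
exact: word_perm_reduced_word.
Qed.

Lemma hbarpi_perm_word w :
  reduced w -> hbarpi_perm (word_perm w) = \prod_(i <- w) hbarpi i.
Proof.
have [_ B C] := hecke_relations_sub1 (hpi_relations K n).
have barE i : hbarpi i = - (1 - pi i) by rewrite opprB.
move=> rw; apply: matsumoto => [i j ij|i j ij|||] //.
- by rewrite !barE !(mulrN, mulNr) !opprK B.
- by rewrite !barE !(mulrN, mulNr) !opprK C.
- exact: reduced_reduced_word.
- exact: word_perm_reduced_word.
Qed.

Fact algC a (x : H) : a%:A * x = x * a%:A.
Proof. by rewrite mulr_algl mulr_algr. Qed.

Definition hphi : H -> H :=
  hlift (c := in_alg H) algC (hecke_relations_rev (hpi_relations K n)).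

HB.instance Definition _ := GRing.RMorphism.on hphi.

Lemma hphi_pi i : hphi (pi i) = pi (rev_ord i). Proof. exact: hlift_pi. Qed.

Fact hphi_scalable : scalable hphi.
Proof. by move=> a x; rewrite -mulr_algl rmorphM -[RHS]mulr_algl; congr (_ * _); exact: hlift_alg. Qed.

HB.instance Definition _ := GRing.isScalable.Build K H H *:%R hphi hphi_scalable.

Fact htheta_relations : hecke_relations (fun i => - hbarpi i).
Proof.
have [I B C] := hecke_relations_sub1 (hpi_relations K n).
by split=> *; rewrite /hbarpi !opprB; auto.
Qed.

Definition htheta : H -> H := hlift (c := in_alg H) algC htheta_relations.

HB.instance Definition _ := GRing.RMorphism.on htheta.

Lemma htheta_pi i : htheta (pi i) = - hbarpi i. Proof. exact: hlift_pi. Qed.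

Fact htheta_scalable : scalable htheta.
Proof. by move=> a x; rewrite -mulr_algl rmorphM -[RHS]mulr_algl; congr (_ * _); exact: hlift_alg. Qed.

HB.instance Definition _ := GRing.isScalable.Build K H H *:%R htheta htheta_scalable.

Definition in_alg_conv a : H^c := a%:A.

Fact in_alg_conv_zmod_morphism : zmod_morphism in_alg_conv.
Proof. by move=> a b; rewrite /in_alg_conv scalerBl. Qed.

Fact in_alg_conv_monoid_morphism : monoid_morphism in_alg_conv.
Proof.
split=> [|a b]; first by rewrite /in_alg_conv scale1r.
rewrite /in_alg_conv mulrC -scalerA; exact: esym (mulr_algl b (a%:A : H)).
Qed.

HB.instance Definition _ :=
  GRing.isZmodMorphism.Build K H^c in_alg_conv in_alg_conv_zmod_morphism.
HB.instance Definition _ :=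
  GRing.isMonoidMorphism.Build K H^c in_alg_conv in_alg_conv_monoid_morphism.

Fact in_alg_convC a (x : H^c) : in_alg_conv a * x = x * in_alg_conv a.
Proof. by rewrite /in_alg_conv /GRing.mul /= algC. Qed.

(* an anti-endomorphism of H is a morphism from H to the converse ring H^c *)
Definition hchi : H -> H^c :=
  hlift in_alg_convC (hecke_relations_conv (hpi_relations K n)).

HB.instance Definition _ := GRing.RMorphism.on hchi.

Lemma hchi_pi i : hchi (pi i) = pi i. Proof. exact: hlift_pi. Qed.

Lemma hchi_alg a : hchi a%:A = a%:A. Proof. exact: hlift_alg. Qed.

Lemma hchiM x y : hchi (x * y) = (hchi y : H) * (hchi x : H).
Proof. exact: rmorphM. Qed.

Lemma hchiZ a x : hchi (a *: x) = a *: (hchi x : H).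
Proof. by rewrite -mulr_algl hchiM hchi_alg mulr_algr. Qed.

Lemma hphiK : involutive hphi.
Proof.
elim/hecke_ind => [a|i|x y hx hy|x y hx hy].
- by rewrite !rmorph_alg.
- by rewrite !hphi_pi rev_ordK.
- by rewrite !rmorphD /= hx hy.
- by rewrite !rmorphM /= hx hy.
Qed.

Lemma hthetaK : involutive htheta.
Proof.
elim/hecke_ind => [a|i|x y hx hy|x y hx hy].
- by rewrite !rmorph_alg.
- rewrite htheta_pi /hbarpi rmorphN rmorphB rmorph1 /= htheta_pi /hbarpi.
  by rewrite !opprB addrC subrK.
- by rewrite !rmorphD /= hx hy.
- by rewrite !rmorphM /= hx hy.
Qed.

Lemma hchiK : involutive (hchi : H -> H).
Proof.
elim/hecke_ind => [a|i|x y hx hy|x y hx hy].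
- by rewrite !hchi_alg.
- by rewrite !hchi_pi.
- by rewrite !rmorphD /= hx hy.
- by rewrite !hchiM hx hy.
Qed.

End Algebra.

Definition lmod_iso (A : pzRingType) (M N : lmodType A) : Prop :=
  exists f : {linear M -> N}, bijective f.

Definition twist (A : pzRingType) (mu : {rmorphism A -> A}) (M : lmodType A) : Type :=
  M.

Section Twist.

Variables (A : pzRingType) (mu : {rmorphism A -> A}) (M : lmodType A).

HB.instance Definition _ := GRing.Zmodule.on (twist mu M).

Definition twist_scale (a : A) (v : twist mu M) : twist mu M := mu a *: (v : M).

Fact twist_scaleA a b v : twist_scale a (twist_scale b v) = twist_scale (a * b) v.
Proof. by rewrite /twist_scale scalerA rmorphM. Qed.
Fact twist_scale1 : left_id 1 twist_scale.
Proof. by move=> v; rewrite /twist_scale rmorph1 scale1r. Qed.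
Fact twist_scaleDr : right_distributive twist_scale +%R.
Proof. by move=> a u v; apply: scalerDr. Qed.
Fact twist_scaleDl v : {morph twist_scale^~ v : a b / a + b}.
Proof. by move=> a b; rewrite /twist_scale rmorphD; apply: scalerDl. Qed.

HB.instance Definition _ := GRing.Zmodule_isLmodule.Build A (twist mu M)
  twist_scaleA twist_scale1 twist_scaleDr twist_scaleDl.

End Twist.

(* K-linear forms on a module over a K-algebra; k in K acts on M as k%:A *)
Definition linear_form (K : fieldType) (A : algType K) (M : lmodType A) :
    {pred M -> K} :=
  fun d => `[< (forall u v, d (u + v) = d u + d v) /\
               (forall (k : K) u, d ((k%:A : A) *: u) = k * d u) >].

Arguments linear_form {K A} M.

(* the twisted dual nu[M], for an anti-endomorphism nu of A *)
Record dual_twist (K : fieldType) (A : algType K) (nu : {rmorphism A -> A^c})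
    (M : lmodType A) : Type := DualTwist {
  dual_fun :> M -> K;
  dual_funP : dual_fun \in linear_form M
}.

Section DualTwist.

Variables (K : fieldType) (A : algType K) (nu : {rmorphism A -> A^c}).
Variable (M : lmodType A).
Local Notation D := (dual_twist nu M).

Fact linear_form_zmod_closed : zmod_closed (linear_form M).
Proof.
split; first by apply/asboolP; split=> [u v|k u]; rewrite ?addr0 ?mulr0.
move=> d e /asboolP[dD dZ] /asboolP[eD eZ]; apply/asboolP; split=> [u v|k u].
  by rewrite /= !fctE dD eD opprD addrACA.
by rewrite /= !fctE dZ eZ mulrBr.
Qed.

HB.instance Definition _ :=
  GRing.isZmodClosed.Build (M -> K) (linear_form M) linear_form_zmod_closed.
HB.instance Definition _ := [isSub for @dual_fun K A nu M].
HB.instance Definition _ := [Choice of D by <:].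
HB.instance Definition _ := [SubChoice_isSubZmodule of D by <:].

Fact dual_scale_subproof (a : A) (d : D) :
  (fun v => d ((nu a : A) *: v)) \in linear_form M.
Proof.
have /asboolP[dD dZ] := dual_funP d; apply/asboolP; split=> [u v|k u].
  by rewrite scalerDr dD.
by rewrite scalerA mulr_algr -mulr_algl -scalerA dZ.
Qed.

Definition dual_scale (a : A) (d : D) : D := DualTwist nu (dual_scale_subproof a d).

Fact dual_scaleA a b d : dual_scale a (dual_scale b d) = dual_scale (a * b) d.
Proof.
apply/val_inj/funext => v /=; rewrite scalerA; congr (dual_fun d (_ *: _)).
by rewrite rmorphM.
Qed.
Fact dual_scale1 : left_id 1 dual_scale.
Proof. by move=> d; apply/val_inj/funext => v /=; rewrite rmorph1 scale1r. Qed.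
Fact dual_scaleDr : right_distributive dual_scale +%R.
Proof. by move=> a d e; apply/val_inj/funext. Qed.
Fact dual_scaleDl d : {morph dual_scale^~ d : a b / a + b}.
Proof.
move=> a b; apply/val_inj/funext => v /=; have /asboolP[dD _] := dual_funP d.
by rewrite rmorphD /= scalerDl dD.
Qed.

HB.instance Definition _ := GRing.Zmodule_isLmodule.Build A D
  dual_scaleA dual_scale1 dual_scaleDr dual_scaleDl.

End DualTwist.

(* The left ideal A e, as a submodule of the regular left module A^o. *)
Definition left_ideal_pred (A : pzRingType) (e : A) : {pred A^o} :=
  fun x => `[< exists a : A, x = a * e >].

Record left_ideal (A : pzRingType) (e : A) : Type := LeftIdeal {
  left_ideal_val :> A^o;
  left_ideal_valP : left_ideal_val \in left_ideal_pred e
}.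

Section LeftIdeal.

Variables (A : pzRingType) (e : A).

Fact left_ideal_submod_closed : submod_closed (left_ideal_pred e).
Proof.
split; first by apply/asboolP; exists 0; rewrite mul0r.
move=> a u v /asboolP[b ->] /asboolP[c ->]; apply/asboolP.
by exists (a * b + c); rewrite mulrDl -mulrA.
Qed.

HB.instance Definition _ :=
  GRing.isSubmodClosed.Build A A^o (left_ideal_pred e) left_ideal_submod_closed.
HB.instance Definition _ := [isSub for @left_ideal_val A e].
HB.instance Definition _ := [Choice of left_ideal e by <:].
HB.instance Definition _ := [SubChoice_isSubZmodule of left_ideal e by <:].
HB.instance Definition _ := [SubZmodule_isSubLmodule of left_ideal e by <:].

End LeftIdeal.

(* The endomorphism ring of a finite-dimensional space, with
   (f * g) v = f (g v); it may be the zero ring. *)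
Definition endo (K : fieldType) (V : vectType K) : Type := 'End(V).

Section Endo.

Variables (K : fieldType) (V : vectType K).

HB.instance Definition _ := GRing.Zmodule.on (endo V).
HB.instance Definition _ := GRing.Zmodule_isPzRing.Build (endo V)
  (@comp_lfunA _ _ _ _ _) (@comp_lfun1l _ _ _) (@comp_lfun1r _ _ _)
  (@comp_lfunDl _ _ _ _) (@comp_lfunDr _ _ _ _).

Definition endo_scalar (k : K) : endo V := (k *: \1)%VF.

Fact endo_scalar_zmod_morphism : zmod_morphism endo_scalar.
Proof. by move=> a b; apply: scalerBl. Qed.
Fact endo_scalar_monoid_morphism : monoid_morphism endo_scalar.
Proof.
split=> [|a b]; first exact: scale1r.
by apply/lfunP => v; rewrite !lfunE /= !lfunE /= !lfunE /= scalerA.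
Qed.

HB.instance Definition _ :=
  GRing.isZmodMorphism.Build K (endo V) endo_scalar endo_scalar_zmod_morphism.
HB.instance Definition _ :=
  GRing.isMonoidMorphism.Build K (endo V) endo_scalar endo_scalar_monoid_morphism.

Fact endo_scalarC a (f : endo V) : endo_scalar a * f = f * endo_scalar a.
Proof.
apply/lfunP => v; rewrite !lfunE /= !lfunE /= !lfunE /=.
by rewrite linearZ.
Qed.

End Endo.

(* The H_n(0)-module on V in which the i-th generator acts by T i. *)
Definition hecke_module (K : fieldType) (n : nat) (V : vectType K)
  (T : 'I_n.-1 -> endo V) (TT : hecke_relations T) : Type := V.

Section HeckeModule.

Variables (K : fieldType) (n : nat) (V : vectType K).
Variables (T : 'I_n.-1 -> endo V) (TT : hecke_relations T).
Local Notation M := (hecke_module TT).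

HB.instance Definition _ := GRing.Zmodule.on M.

Definition hecke_scale (x : hecke K n) (v : M) : M :=
  (hlift (@endo_scalarC K V) TT x : 'End(V)) v.

Fact hecke_scaleA x y v : hecke_scale x (hecke_scale y v) = hecke_scale (x * y) v.
Proof. by rewrite /hecke_scale rmorphM [RHS]lfunE. Qed.
Fact hecke_scale1 : left_id 1 hecke_scale.
Proof. by move=> v; rewrite /hecke_scale rmorph1 [LHS]lfunE. Qed.
Fact hecke_scaleDr : right_distributive hecke_scale +%R.
Proof. by move=> x u v; rewrite /hecke_scale linearD. Qed.
Fact hecke_scaleDl v : {morph hecke_scale^~ v : x y / x + y}.
Proof. by move=> x y; rewrite /hecke_scale rmorphD [LHS]lfunE. Qed.

HB.instance Definition _ := GRing.Zmodule_isLmodule.Build (hecke K n) M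
  hecke_scaleA hecke_scale1 hecke_scaleDr hecke_scaleDl.

Lemma hecke_module_piE i (v : M) : hpi K i *: v = (T i : 'End(V)) v.
Proof. by rewrite /GRing.scale /= /hecke_scale hlift_pi. Qed.

Lemma hecke_module_algE (k : K) (v : M) : k%:A *: v = (k *: (v : V) : V).
Proof. by rewrite [LHS]/GRing.scale /= /hecke_scale hlift_alg !lfunE /= lfunE. Qed.

End HeckeModule.

Section IntervalSpace.

Variables (K : fieldType) (n : nat) (s r : 'S_n).
Implicit Types (g : 'S_n) (i j : 'I_n.-1).

Local Notation s_ := (@simple_tperm n).
Local Notation I := (weak_interval s r).

Definition interval_space : vectType K := {ffun {g : 'S_n | g \in I} -> K^o}.
Local Notation V := interval_space.

(* the basis vector of g, and 0 if g is not in [s, r]_L *)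
Definition ivec g : V := [ffun x => (val x == g)%:R : K^o].

Lemma ivec_out g : g \notin I -> ivec g = 0.
Proof.
move=> gI; apply/ffunP => x; rewrite !ffunE; case: eqP => // xg.
by move: (valP x) gI; rewrite /= xg => ->.
Qed.

Lemma ivec_sum (v : V) : v = \sum_x (v x : K) *: ivec (val x).
Proof.
apply/ffunP => y; rewrite sum_ffunE (bigD1 y) //= big1 => [|x xy].
  by rewrite !ffunE eqxx addr0 /GRing.scale /= mulr1.
by rewrite !ffunE (inj_eq val_inj) eq_sym (negPf xy) /GRing.scale /= mulr0.
Qed.

Definition linear_ext (b : 'S_n -> V) (v : V) : V :=
  \sum_x (v x : K) *: b (val x).

Fact linear_ext_is_linear b : linear (linear_ext b).
Proof.
move=> k u v; rewrite /linear_ext scaler_sumr -big_split /=.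
by apply: eq_bigr => x _; rewrite !ffunE scalerDl scalerA.
Qed.

HB.instance Definition _ b :=
  GRing.isLinear.Build K V V *:%R (linear_ext b) (linear_ext_is_linear b).

Definition endo_ext (b : 'S_n -> V) : endo V := linfun (linear_ext b).

Lemma endo_ext_ivec b g : g \in I -> (endo_ext b : 'End(V)) (ivec g) = b g.
Proof.
move=> gI; rewrite lfunE /= /linear_ext (bigD1 (Sub g gI)) //= big1 => [|x xg].
  by rewrite !ffunE SubK eqxx scale1r addr0.
rewrite !ffunE; case: eqP => [e|_]; last by rewrite scale0r.
by case/eqP: xg; apply: val_inj; rewrite SubK.
Qed.

Lemma endo_eq (f h : endo V) :
  (forall g, g \in I -> (f : 'End(V)) (ivec g) = (h : 'End(V)) (ivec g)) -> f = h.
Proof.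
move=> fh; apply/lfunP => v; rewrite (ivec_sum v) !linear_sum.
by apply: eq_bigr => x _; rewrite !linearZ /= fh ?(valP x).
Qed.

Lemma endo_mulE (f h : endo V) (v : V) :
  ((f * h : endo V) : 'End(V)) v = (f : 'End(V)) ((h : 'End(V)) v).
Proof. exact: lfunE. Qed.

Lemma endo_addE (f h : endo V) (v : V) :
  ((f + h : endo V) : 'End(V)) v = (f : 'End(V)) v + (h : 'End(V)) v.
Proof. exact: lfunE. Qed.

Lemma endo_oppE (f : endo V) (v : V) :
  ((- f : endo V) : 'End(V)) v = - (f : 'End(V)) v.
Proof. exact: lfunE. Qed.

Lemma endo_oneE (v : V) : ((1 : endo V) : 'End(V)) v = v.
Proof. exact: lfunE. Qed.

Definition B_action i g : V :=
  if i \in DesL g then ivec g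
  else if s_ i ∘ g \in I then ivec (s_ i ∘ g)
  else 0.

Definition Bbar_action i g : V :=
  if i \in DesL g then - ivec g
  else if s_ i ∘ g \in I then ivec (s_ i ∘ g)
  else 0.

Definition B_op i : endo V := endo_ext (B_action i).

(* pi_i = bar pi_i + 1 *)
Definition Bbar_op i : endo V := endo_ext (Bbar_action i) + 1.

Lemma B_op_step i g : leL s g ->
  (B_op i : 'End(V)) (ivec g) = ivec (hecke_step i g).
Proof.
move=> sg; have [gI|gI] := boolP (g \in I); last first.
  rewrite (ivec_out gI) linear0 ivec_out //; apply: contra gI.
  by rewrite !inE sg => /andP[_]; apply: leL_trans (leL_step i g).
rewrite endo_ext_ivec // /B_action /hecke_step; case: ifP => // _.
by case: ifPn => // /ivec_out ->.
Qed.

Lemma leL_hecke_step i g : leL s g -> leL s (hecke_step i g).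
Proof. by move=> sg; apply: leL_trans sg (leL_step i g). Qed.

Lemma B_relations : hecke_relations B_op.
Proof.
split=> [i|i j ij|i j ij]; apply: endo_eq => g; rewrite inE => /andP[sg _];
  rewrite !endo_mulE !B_op_step ?leL_hecke_step //.
- by rewrite hecke_step_idem.
- by rewrite hecke_step_braid.
- by rewrite hecke_step_comm.
Qed.

Let sgn : endo V := endo_ext (fun g => (-1) ^+ odd_perm g *: ivec g).

Let sgnE g : (sgn : 'End(V)) (ivec g) = (-1) ^+ odd_perm g *: ivec g.
Proof.
have [gI|gI] := boolP (g \in I); first exact: endo_ext_ivec.
by rewrite ivec_out // linear0 scaler0.
Qed.

Let sgnK : sgn * sgn = 1.
Proof.
apply: endo_eq => g gI; rewrite endo_mulE endo_oneE sgnE linearZ /= sgnE.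
by rewrite scalerA -signr_addb addbb scale1r.
Qed.

Lemma Bbar_opE i : Bbar_op i = 1 - sgn * B_op i * sgn.
Proof.
rewrite /Bbar_op addrC; congr (_ + _); apply: endo_eq => g gI.
rewrite endo_oppE !endo_mulE sgnE !linearZ /= scalerN !endo_ext_ivec //.
rewrite /Bbar_action /B_action; case: ifP => _.
  by rewrite sgnE scalerA -signr_addb addbb scale1r.
case: ifP => _; last by rewrite linear0 scaler0 oppr0.
rewrite sgnE scalerA -signr_addb /pcomp odd_permM /simple_tperm odd_tperm.
by rewrite ord_lo_neq_hi addbT addbN addbb /= expr1 scaleN1r opprK.
Qed.

Lemma Bbar_relations : hecke_relations Bbar_op.
Proof.
have [BI BB BC] := B_relations.
have SS f h : sgn * f * sgn * (sgn * h * sgn) = sgn * (f * h) * sgn.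
  by rewrite !mulrA -[sgn * f * sgn * sgn]mulrA sgnK mulr1.
have CR : hecke_relations (fun i => sgn * B_op i * sgn).
  by split=> [i|i j ij|i j ij]; rewrite !SS ?BI ?(BB _ _ ij) ?(BC _ _ ij).
have [I' B' C'] := hecke_relations_sub1 CR.
by split=> *; rewrite !Bbar_opE; auto.
Qed.

End IntervalSpace.

Definition B_module (K : fieldType) (n : nat) (s r : 'S_n) : lmodType (hecke K n) :=
  hecke_module (@B_relations K n s r).

Definition Bbar_module (K : fieldType) (n : nat) (s r : 'S_n) :
    lmodType (hecke K n) :=
  hecke_module (@Bbar_relations K n s r).

Lemma B_moduleE (K : fieldType) (n : nat) (s r g : 'S_n) (i : 'I_n.-1) :
  g \in weak_interval s r ->
  hpi K i *: (ivec K s r g : B_module K s r) = B_action K s r i g.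
Proof. by move=> gI; rewrite hecke_module_piE endo_ext_ivec. Qed.

Lemma Bbar_moduleE (K : fieldType) (n : nat) (s r g : 'S_n) (i : 'I_n.-1) :
  g \in weak_interval s r ->
  hbarpi K i *: (ivec K s r g : Bbar_module K s r) = Bbar_action K s r i g.
Proof.
move=> gI; rewrite /hbarpi scalerBl scale1r hecke_module_piE.
by rewrite endo_addE endo_oneE endo_ext_ivec // addrK.
Qed.

Definition P_module (K : fieldType) (n : nat) (a : composition n) :
    lmodType (hecke K n) :=
  left_ideal (hpi_perm K (parabolic_longest (comp_set (comp_compl a))) *
              hbarpi_perm K (parabolic_longest (comp_set a))).

(* Main.v *)
Require Import Defs.
From HB Require Import structures.
From mathcomp Require Import all_boot all_fingroup all_algebra.
From mathcomp Require Import reals complex.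
From mathcomp Require Import boolp functions zify.

(** Parts (1), (2) and the first half of (3) are comparisons of bases.
    Conjugation by w_0 is an automorphism of the left weak order that sends s_i
    to s_(n-i), whence (1).  Rescaling the basis vector of g by the sign of g
    turns 1 - pi_i, the action of pi_i on theta[B], into the action of pi_i on
    the negative module, whence (2).  Right multiplication by w_0 reverses the
    left weak order and complements left descent sets, so that sending the
    dual basis vector of g to the basis vector of g w_0 gives (3).  In all
    three cases it is enough to compare coordinates ([icoord_B],
    [icoord_Bbar]).

    For the projective modules, fix a set J of generators with complement J^c,
    and let w_J be the longest element of the parabolic subgroup of J.

    - The permutations whose right descent set is J^c form the interval
      [w_(J^c), w_0 w_J]_L ([descent_class]).  The point is that
      w_J <=_L g as soon as J consists of right descents of g: then
      pi_g pi_(w_J) = pi_g, and applying both sides to the identity in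
      B(1, w_0) exhibits g as reached from w_J by steps up the weak order.

    - The map g |-> pi_g bar pi_(w_J) is a homomorphism from
      B(w_(J^c), w_0 w_J) onto P = H pi_(w_(J^c)) bar pi_(w_J)
      ([P_hom_linear]), and it stays injective after right multiplication by
      pi_(w_(J^c)) ([P_hom_mul_inj]): up to the anti-involution chi, the element
      pi_g bar pi_(w_J) pi_(w_(J^c)) sends the identity of B(1, w_0) to
      +- g^-1 plus longer permutations.  So P is isomorphic to
      B(w_(J^c), w_0 w_J) ([B_P_ideal]).

    - Twisting by theta exchanges pi and bar pi up to sign.  The same
      injectivity, for J^c, embeds theta[B(w_J, w_0 w_(J^c))] into P by
      v |-> theta(v) bar pi_(w_J).  The two intervals are exchanged by left
      multiplication by w_0, so the dimensions agree and this embedding is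
      an isomorphism ([theta_B_P_ideal], stated for the complement of J).  Hence
      P is also isomorphic to the negative module of [w_J, w_0 w_(J^c)]_L.

    Consequently chi[P] is the negative module of
    [w_0 w_J w_0, w_(J^c) w_0]_L.  Conjugation by w_0 sends w_J to w_(J'),
    where J' is the mirror image of J, so this interval is
    [w_(J'), w_0 w_(J'^c)]_L, and the module is the projective module of J'
    ([chi_P_ideal]).  For J = set(alpha), the set J' is set(alpha^r)
    ([comp_set_rev]). *)

Set Implicit Arguments.
Unset Strict Implicit.
Unset Printing Implicit Defensive.

(* pcomp is composition of permutations, not of partial functions. *)
Import GRing.Theory Defs.
Local Open Scope sym_scope.

(** * The longest element, parabolic subgroups and the left weak order *)

Section Permutations.

Variable n : nat.
Implicit Types (s t g r : 'S_n) (i j : 'I_n.-1) (w : seq 'I_n.-1) (J : {set 'I_n.-1}).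

Local Notation s_ := (@simple_tperm n).

Lemma word_perm_rev w : word_perm (rev w) = ((word_perm w)^-1)%g.
Proof.
elim: w => [|i w IHw]; first by rewrite /= invg1.
rewrite rev_cons -cats1 word_perm_cat IHw /= pcomps1 /pcomp invMg.
by rewrite /simple_tperm tpermV.
Qed.

Lemma ellV g : ell (g^-1)%g = ell g.
Proof.
suff le (h : 'S_n) : ell (h^-1)%g <= ell h.
  by apply/eqP; rewrite eqn_leq le -{1}(invgK g) le.
have [w /eqP wh] := ell_word h.
by have := ell_min (rev w); rewrite word_perm_rev wh size_rev size_tuple.
Qed.

(** Strong exchange property: following a and b through the letters of w, their
    order is reversed at some letter, where they are adjacent; deleting that
    letter amounts to multiplying by the transposition of a and b. *)
Lemma exchange (a b : 'I_n) w :
    a < b -> ((word_perm w)^-1)%g b < ((word_perm w)^-1)%g a ->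
  exists w1 j w2, w = w1 ++ j :: w2 /\ tperm a b ∘ word_perm w = word_perm (w1 ++ w2).
Proof.
elim: w a b => [|j w IHw] a b ab /=; first by rewrite invg1 !perm1; lia.
rewrite !simple_tperm_inv.
have [[-> ->]|abj] := pselect (a = ord_lo j /\ b = ord_hi j).
  by exists [::], j, w; rewrite simple_tpermK.
move=> ba; have lt : s_ j a < s_ j b.
  rewrite /simple_tperm.
  have eqE (x y : 'I_n) : (x == y) = (x == y :> nat) by [].
  by move: ab abj; case: tpermP => [->|->|/eqP + /eqP];
    case: tpermP => [->|->|/eqP + /eqP]; rewrite ?eqE /=; try lia; move=> + [].
have [w1 [k [w2 [-> E]]]] := IHw _ _ lt ba.
exists (j :: w1), k, w2; split=> //=; rewrite -E.
have sV : ((s_ j)^-1)%g = s_ j by rewrite /simple_tperm tpermV.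
rewrite -tpermJ conjgE sV; rewrite !/pcomp -!mulgA; congr (_ * _)%g.
by rewrite /simple_tperm tperm2 mulg1.
Qed.

(** Membership in the parabolic subgroup of J, in the form in which reduced
    words are used; see [mem_gen_word] and [gen_word_mem]. *)
Definition gen_word J g := exists w, [/\ all (mem J) w, reduced w & word_perm w = g].

(** A word in J can be shortened to a reduced one without leaving J, because the
    exchange property only deletes letters. *)
Lemma word_perm_gen_word J w : all (mem J) w -> gen_word J (word_perm w).
Proof.
elim: w => [_|i w IHw] /=; first by exists [::]; rewrite /reduced ell1.
case/andP=> iJ /IHw[v [vJ rv <-]] {w IHw}.
have [iD|iD] := boolP (i \in DesL (word_perm v)); last first.
  by exists (i :: v); split; rewrite /= ?iJ ?vJ // /reduced /= ell_up //.
have lt : ord_lo i < ord_hi i by [].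
have := iD; rewrite DesLP => /(exchange lt)[w1 [j [w2 [vE E]]]].
exists (w1 ++ w2); rewrite -E; split=> //.
  by move: vJ; rewrite vE !all_cat /= => /and3P[-> _ ->].
rewrite /reduced -E; have := ell_down iD; move/eqP: rv => ->.
by rewrite vE !size_cat /= addnS => -[->].
Qed.

Definition DesR g : {set 'I_n.-1} := DesL (g^-1)%g.

Lemma mem_gen_word J g : (g \in <<[set s_ i | i in J]>>)%g -> gen_word J g.
Proof.
case/gen_prodgP => k [c cJ ->] {g}.
suff [w [wJ <-]] : exists w, all (mem J) w /\ word_perm w = (\prod_(x < k) c x)%g.
  exact: word_perm_gen_word.
elim: k c cJ => [|k IHk] c cJ; first by exists [::]; rewrite big_ord0.
have [w [wJ wE]] := IHk (fun x => c (widen_ord (leqnSn k) x)) (fun x => cJ _).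
have /imsetP[i iJ cE] := cJ ord_max.
by exists (i :: w); rewrite /= wJ iJ wE big_ord_recr /= cE.
Qed.

Lemma gen_word_mem J g : gen_word J g -> (g \in <<[set s_ i | i in J]>>)%g.
Proof.
case=> w [wJ _ <-]; elim: w wJ => [|i w IHw] /=; first by rewrite group1.
case/andP=> iJ /IHw ?; rewrite groupM // mem_gen //.
by apply/imsetP; exists i.
Qed.

Lemma parabolic_longestP J :
  gen_word J (parabolic_longest J) /\
  (forall g, gen_word J g -> ell g <= ell (parabolic_longest J)).
Proof.
rewrite /parabolic_longest; case: arg_maxnP; first exact: group1.
move=> g gJ gmax; split; first exact: mem_gen_word.
by move=> h /gen_word_mem; apply: gmax.
Qed.

Lemma gen_wordV J g : gen_word J g -> gen_word J (g^-1)%g.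
Proof.
case=> w [wJ _ <-]; rewrite -word_perm_rev; apply: word_perm_gen_word.
by rewrite all_rev.
Qed.

Lemma gen_word_step J i g : i \in J -> gen_word J g -> gen_word J (s_ i ∘ g).
Proof.
move=> iJ [w [wJ _ <-]]; apply: (@word_perm_gen_word _ (i :: w)).
by rewrite /= iJ.
Qed.

(** An ascent in J would give a longer element of the same subgroup. *)
Lemma DesL_parabolic_longest J : J \subset DesL (parabolic_longest J).
Proof.
apply/subsetP => i iJ; have [wJ wmax] := parabolic_longestP J.
apply: contraT => /ell_up e; have := wmax _ (gen_word_step iJ wJ).
by rewrite e ltnn.
Qed.

Lemma DesR_parabolic_longest J : J \subset DesR (parabolic_longest J).
Proof.
apply/subsetP => i iJ; have [wJ wmax] := parabolic_longestP J.
apply: contraT => /ell_up e.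
have := wmax _ (gen_word_step iJ (gen_wordV wJ)).
by rewrite e ellV ltnn.
Qed.

Local Notation w0 := (longest n).

Lemma DesL_longest i : i \in DesL w0.
Proof.
rewrite /longest; case: arg_maxnP => // g _ gmax.
by apply: contraT => /ell_up e; have := gmax (s_ i ∘ g) isT; rewrite /= e ltnn.
Qed.

Lemma ltn_rev_ord (x y : 'I_n) : (rev_ord x < rev_ord y) = (y < x).
Proof. by case: x y => [x xn] [y yn] /=; lia. Qed.

(* Reversing values turns the descents of w0 into ascents, and only the
   identity has no descent. *)
Lemma longestE x : w0 x = rev_ord x.
Proof.
pose u : 'S_n := perm (@rev_ord_inj n).
have uE y : u y = rev_ord y by rewrite permE.
have uV : (u^-1)%g = u.
  by apply/permP => y; apply: (@perm_inj _ u); rewrite permKV !uE rev_ordK.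
have /mulg1_eq : (u * w0)%g = 1%g.
  apply: no_desc => i; rewrite invMg uV !permM !uE.
  by have := DesL_longest i; rewrite DesLP ltn_rev_ord -leqNgt => /ltnW.
by rewrite uV => <-.
Qed.

Lemma longestV : (w0^-1)%g = w0.
Proof.
by apply/permP => x; apply: (@perm_inj _ w0); rewrite permKV !longestE rev_ordK.
Qed.

Lemma longestK g : g ∘ w0 ∘ w0 = g.
Proof. by rewrite /pcomp mulgA -{1}longestV mulVg mul1g. Qed.

Lemma longestKl g : w0 ∘ (w0 ∘ g) = g.
Proof. by rewrite /pcomp -{2}longestV mulgK. Qed.

Lemma DesL_longestr i g : (i \in DesL (g ∘ w0)) = (i \notin DesL g).
Proof.
rewrite !DesLP /pcomp invMg longestV !permM !longestE.
have : (g^-1)%g (ord_lo i) != (g^-1)%g (ord_hi i).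
  by rewrite (inj_eq perm_inj) ord_lo_neq_hi.
rewrite ltn_rev_ord; move: (_ (ord_lo i)) (_ (ord_hi i)) => a b.
by rewrite -val_eqE /=; lia.
Qed.

Lemma rev_ord_lo i : rev_ord (ord_lo i) = ord_hi (rev_ord i).
Proof. by apply: val_inj => /=; have := ltn_ord i; lia. Qed.

Lemma rev_ord_hi i : rev_ord (ord_hi i) = ord_lo (rev_ord i).
Proof. by apply: val_inj => /=; have := ltn_ord i; lia. Qed.

Lemma simple_tperm_conj_longest i : w0 ∘ s_ i = s_ (rev_ord i) ∘ w0.
Proof.
apply/permP => x; rewrite !permM !longestE /simple_tperm -rev_ord_lo -rev_ord_hi.
by rewrite tpermC (inj_tperm _ _ _ (@rev_ord_inj n)).
Qed.

Lemma DesL_longestl i g : (i \in DesL (w0 ∘ g)) = (rev_ord i \notin DesL g).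
Proof.
rewrite !DesLP /pcomp invMg longestV !permM !longestE rev_ord_lo rev_ord_hi.
have : (g^-1)%g (ord_lo (rev_ord i)) != (g^-1)%g (ord_hi (rev_ord i)).
  by rewrite (inj_eq perm_inj) ord_lo_neq_hi.
move: (_ (ord_lo _)) (_ (ord_hi _)) => a b.
by rewrite -val_eqE /=; lia.
Qed.

(** Going up along a left ascent of g goes down along g w_0, since right
    multiplication by w_0 complements left descent sets. *)
Lemma ell_longestr g : ell (g ∘ w0) + ell g = ell w0.
Proof.
move: {2}(ell g) (erefl (ell g)) => k; elim: k g => [|k IHk] g gk.
  by rewrite (ell_eq0 gk) ell1 addn0 pcomp1s.
have [w /eqP wg] := ell_word g; case: w wg; rewrite gk => -[|i w] //= sw wg.
have iD : i \in DesL g.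
  rewrite inE -{1}wg simple_tpermK gk ltnS.
  by have := ell_min w; move/eqP: sw => /= [->].
have e := ell_down iD.
have hk : ell (s_ i ∘ g) = k by move: e; rewrite gk => -[].
rewrite -(IHk _ hk) -pcompA (@ell_down _ i (s_ i ∘ (g ∘ w0))).
  by rewrite simple_tpermK hk addSnnS.
by rewrite DesLs DesL_longestr iD.
Qed.

Lemma ell_longestl g : ell (w0 ∘ g) + ell g = ell w0.
Proof.
by rewrite -(ell_longestr (g^-1)%g) ellV -ellV /pcomp invMg longestV.
Qed.

Lemma leLE s r : leL s r = (ell r == ell (r ∘ (s^-1)%g) + ell s).
Proof.
apply/existsP/idP => [[g /andP[/eqP rE]]|e]; last first.
  by exists (r ∘ (s^-1)%g); rewrite e andbT /pcomp mulKVg.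
by have -> : r ∘ (s^-1)%g = g by rewrite rE /pcomp mulKg.
Qed.

Lemma leL_longestr s r : leL (r ∘ w0) (s ∘ w0) = leL s r.
Proof.
rewrite !leLE; have := ell_longestr s; have := ell_longestr r.
suff -> : ell (s ∘ w0 ∘ ((r ∘ w0)^-1)%g) = ell (r ∘ (s^-1)%g) by move=> *; lia.
by rewrite -ellV /pcomp !invMg !invgK !mulgA mulgKV ?invgK.
Qed.

Lemma leL_longestl s r : leL (w0 ∘ r) (w0 ∘ s) = leL s r.
Proof.
rewrite !leLE; have := ell_longestl s; have := ell_longestl r.
have := ell_longestl (r ∘ (s^-1)%g ∘ w0); have := ell_longestr (r ∘ (s^-1)%g).
suff -> : ell (w0 ∘ s ∘ ((w0 ∘ r)^-1)%g) = ell (w0 ∘ (r ∘ (s^-1)%g ∘ w0)).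
  by move=> *; lia.
by rewrite -ellV /pcomp !invMg !invgK longestV !mulgA.
Qed.

Lemma leL_conj_longest s r : leL (conj_longest s) (conj_longest r) = leL s r.
Proof. by rewrite leL_longestr leL_longestl. Qed.

Lemma conj_longestK : involutive (@conj_longest n).
Proof. by move=> g; rewrite /conj_longest -!pcompA longestKl !pcompA longestK. Qed.

Lemma DesL_conj_longest i g : (i \in DesL (conj_longest g)) = (rev_ord i \in DesL g).
Proof. by rewrite DesL_longestr DesL_longestl negbK. Qed.

Lemma conj_longest_simple i g :
  conj_longest (s_ i ∘ g) = s_ (rev_ord i) ∘ conj_longest g.
Proof. by rewrite /conj_longest !pcompA simple_tperm_conj_longest -!pcompA. Qed.

End Permutations.

Local Open Scope ring_scope.

(** * Module isomorphisms *)

Lemma inj_surj_bij (T U : Type) (f : T -> U) :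
  injective f -> (forall y, exists x, f x = y) -> bijective f.
Proof.
move=> fI fS; pose h y := projT1 (cid (fS y)).
have hK : cancel h f by move=> y; rewrite /h; case: cid.
by exists h => // x; apply: fI; rewrite hK.
Qed.

Lemma lmod_isoI (A : pzRingType) (M N : lmodType A) (f : M -> N) :
  linear f -> bijective f -> lmod_iso M N.
Proof.
move=> flin fbij.
pose F : {linear M -> N} := HB.pack f (GRing.isLinear.Build A M N *:%R f flin).
by exists F.
Qed.

Lemma lmod_iso_sym (A : pzRingType) (M N : lmodType A) :
  lmod_iso M N -> lmod_iso N M.
Proof.
case=> f [h fK hK]; apply: (@lmod_isoI _ _ _ h); last by exists f.
exact: can2_linear fK hK.
Qed.

Lemma lmod_iso_trans (A : pzRingType) (M N P : lmodType A) :
  lmod_iso M N -> lmod_iso N P -> lmod_iso M P.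
Proof.
move=> [f fB] [g gB]; apply: (@lmod_isoI _ _ _ (g \o f)); last exact: bij_comp.
by move=> a u v /=; rewrite !linearP.
Qed.

(** Over the 0-Hecke algebra, linearity is a statement about scalars and
    generators only. *)
Lemma hecke_linear (K : fieldType) (n : nat) (M N : lmodType (hecke K n)) (f : M -> N) :
    (forall (k : K) u v, f (k%:A *: u + v) = k%:A *: f u + f v) ->
    (forall i v, f (hpi K i *: v) = hpi K i *: f v) ->
  linear f.
Proof.
move=> fK fpi.
have fD u v : f (u + v) = f u + f v.
  by have := fK 1 u v; rewrite !scale1r.
have f0 : f 0 = 0 by apply: (@addrI _ (f 0)); rewrite -fD !addr0.
suff fZ a u : f (a *: u) = a *: f u by move=> a u v; rewrite fD fZ.
elim/hecke_ind: a u => [k|i|a b IHa IHb|a b IHa IHb] u.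
- by rewrite -[k%:A *: u]addr0 fK f0 addr0.
- exact: fpi.
- by rewrite !scalerDl fD IHa IHb.
- by rewrite -!scalerA IHa IHb.
Qed.

Lemma lmod_iso_dual (K : fieldType) (A : algType K) (nu : {rmorphism A -> A^c})
    (M N : lmodType A) :
  lmod_iso M N -> lmod_iso (dual_twist nu N) (dual_twist nu M).
Proof.
case=> f [h fK hK].
have formP (M1 M2 : lmodType A) (g : {linear M1 -> M2}) (d : dual_twist nu M2) :
    (fun v => d (g v)) \in linear_form M1.
  have /asboolP[dD dZ] := dual_funP d.
  by apply/asboolP; split=> [u v|k u]; rewrite ?linearD ?linearZ ?dD ?dZ.
pose H : {linear N -> M} :=
  HB.pack h (GRing.isLinear.Build A N M *:%R h (can2_linear fK hK)).
pose F (d : dual_twist nu N) : dual_twist nu M := DualTwist nu (formP _ _ f d).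
pose G (d : dual_twist nu M) : dual_twist nu N := DualTwist nu (formP _ _ H d).
apply: (@lmod_isoI _ _ _ F); last first.
  by exists G => d; apply/val_inj/funext => v /=; rewrite ?fK ?hK.
move=> a d e; apply/val_inj/funext => v.
change (d ((nu a : A) *: f v) + e (f v) = d (f ((nu a : A) *: v)) + e (f v)).
by rewrite linearZ.
Qed.

(** * Interval modules under phi, theta and chi *)

Lemma hphi_alg (K : fieldType) n (k : K) : hphi (k%:A : hecke K n) = k%:A.
Proof. exact: rmorph_alg. Qed.

Lemma htheta_alg (K : fieldType) n (k : K) : htheta (k%:A : hecke K n) = k%:A.
Proof. exact: rmorph_alg. Qed.

Section Coordinates.

Variables (K : fieldType) (n : nat).
Implicit Types (s r g h : 'S_n) (i : 'I_n.-1).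

Local Notation s_ := (@simple_tperm n).

(** Coordinates are extended by 0 outside of the interval: formulas that involve
    s_i g then need no distinction of whether s_i g lies in the interval. *)
Definition icoord s r (v : interval_space K s r) g : K :=
  oapp (fun x : {h | h \in weak_interval s r} => v x : K) 0 (insub g).

Definition vec_of s r (c : 'S_n -> K) : interval_space K s r :=
  [ffun x => c (val x) : K^o].

Section OneInterval.

Variables (s r : 'S_n).
Local Notation I := (weak_interval s r).
Implicit Types (u v : interval_space K s r).

Lemma icoord_val v x : icoord v (val x) = v x.
Proof. by rewrite /icoord valK. Qed.

Lemma icoord_out v g : g \notin I -> icoord v g = 0.
Proof. by move=> gI; rewrite /icoord insubN. Qed.

Lemma icoordP k u v g : icoord (k *: u + v) g = k * icoord u g + icoord v g.
Proof.
rewrite /icoord; case: insubP => [x _ _|_] /=; last by rewrite mulr0 addr0.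
by rewrite !ffunE.
Qed.

Lemma icoordD u v g : icoord (u + v) g = icoord u g + icoord v g.
Proof. by have := icoordP 1 u v g; rewrite scale1r mul1r. Qed.

Lemma icoord0 g : icoord (0 : interval_space K s r) g = 0.
Proof. by rewrite /icoord; case: insubP => [x _ _|_] //=; rewrite ffunE. Qed.

Lemma icoordN u g : icoord (- u) g = - icoord u g.
Proof. by apply/eqP; rewrite -addr_eq0 -icoordD addNr icoord0. Qed.

Lemma icoord_inj u v : {in I, icoord u =1 icoord v} -> u = v.
Proof. by move=> uv; apply/ffunP => x; rewrite -!icoord_val uv ?(valP x). Qed.

Lemma icoord_vec_of c g : g \in I -> icoord (vec_of s r c) g = c g.
Proof. by move=> gI; rewrite /icoord insubT /= ffunE. Qed.

Lemma icoord_ivec g h : g \in I -> icoord (ivec K s r h) g = (g == h)%:R.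
Proof. by move=> gI; rewrite /icoord insubT /= ffunE. Qed.

Lemma icoord_sum (J : finType) (F : J -> interval_space K s r) g :
  icoord (\sum_x F x) g = \sum_x icoord (F x) g.
Proof. by apply: (big_morph (fun v => icoord v g)) => [u v|]; rewrite ?icoordD ?icoord0. Qed.

Lemma icoordZ k u g : icoord (k *: u) g = k * icoord u g.
Proof. by rewrite -[k *: u]addr0 icoordP icoord0 addr0. Qed.

Lemma sum_interval (F : 'S_n -> K) v :
  \sum_(x : {g : 'S_n | g \in I}) v x * F (val x) = \sum_h icoord v h * F h.
Proof.
rewrite [RHS](bigID (mem I)) /= [X in _ + X]big1 ?addr0 => [|h hI]; last first.
  by rewrite icoord_out ?mul0r.
rewrite (reindex_omap (val : {g | g \in I} -> 'S_n) insub) /=; last first.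
  by move=> h hI; rewrite insubT.
by apply: eq_big => x; rewrite ?(valP x) ?valK ?eqxx // icoord_val.
Qed.

Lemma sum_pick (F : 'S_n -> K) h : \sum_g F g * (h == g)%:R = F h.
Proof.
rewrite (bigD1 h) //= eqxx mulr1 big1 ?addr0 // => g.
by rewrite eq_sym => /negPf->; rewrite mulr0.
Qed.

Lemma icoord_endo_ext (b : 'S_n -> interval_space K s r) v g :
  icoord ((endo_ext b : 'End(_)) v) g = \sum_h icoord v h * icoord (b h) g.
Proof.
rewrite lfunE /= /linear_ext icoord_sum -sum_interval.
by apply: eq_bigr => x _; rewrite icoordZ.
Qed.

(** The common core of both actions: a basis vector h reaches the coordinate g
    only if h = g, or if h = s_i g goes up to g. *)
Lemma icoord_sum_step (a b : K) v g i : g \in I ->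
  \sum_h icoord v h * (if i \in DesL h then a * (g == h)%:R
                      else b * (g == s_ i ∘ h)%:R)
  = if i \in DesL g then a * icoord v g + b * icoord v (s_ i ∘ g) else 0.
Proof.
move=> gI; have flip h : (g == s_ i ∘ h) = (s_ i ∘ g == h).
  by apply/eqP/eqP => [->|<-]; rewrite simple_tpermK.
transitivity (\sum_h (icoord v h * (if i \in DesL h then a else 0)) * (g == h)%:R +
    \sum_h (icoord v h * (if i \in DesL h then 0 else b)) * (s_ i ∘ g == h)%:R).
  rewrite -big_split; apply: eq_bigr => h _ /=; rewrite flip.
  by case: ifP; rewrite !(mulr0, mul0r, addr0, add0r) mulrA.
rewrite !sum_pick DesLs; case: (i \in DesL g) => /=.
  by rewrite ![_ * icoord _ _]mulrC.
by rewrite !mulr0 addr0.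
Qed.

Lemma icoord_step h g i : g \in I ->
  icoord (if s_ i ∘ h \in I then ivec K s r (s_ i ∘ h) else 0) g
    = (g == s_ i ∘ h)%:R.
Proof.
move=> gI; case: ifPn => hI; first exact: icoord_ivec.
by rewrite icoord0; case: eqP => // gE; rewrite -gE gI in hI.
Qed.

Lemma icoord_B_op i v g : g \in I ->
  icoord ((B_op K s r i : 'End(_)) v) g =
    if i \in DesL g then icoord v g + icoord v (s_ i ∘ g) else 0.
Proof.
move=> gI; have := icoord_sum_step 1 1 v i gI; rewrite !mul1r => <-.
rewrite icoord_endo_ext; apply: eq_bigr => h _; rewrite /B_action; congr (_ * _).
by case: ifP => _; rewrite ?icoord_step ?icoord_ivec ?mul1r.
Qed.

Lemma icoord_Bbar_op i v g : g \in I ->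
  icoord ((Bbar_op K s r i : 'End(_)) v) g =
    if i \in DesL g then icoord v (s_ i ∘ g) else icoord v g.
Proof.
move=> gI; rewrite endo_addE endo_oneE icoordD icoord_endo_ext.
transitivity ((if i \in DesL g then -1 * icoord v g + 1 * icoord v (s_ i ∘ g) else 0)
    + icoord v g); last first.
  by case: ifP; rewrite ?add0r // mul1r mulN1r addrAC addNr add0r.
congr (_ + _); rewrite -icoord_sum_step //.
apply: eq_bigr => h _; rewrite /Bbar_action; congr (_ * _).
by case: ifP => _; rewrite ?icoord_step ?icoordN ?icoord_ivec ?mul1r ?mulN1r.
Qed.

Lemma icoord_B i (v : B_module K s r) g : g \in I ->
  icoord (hpi K i *: v : B_module K s r) g =
    if i \in DesL g then icoord v g + icoord v (s_ i ∘ g) else 0.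
Proof. by move=> gI; rewrite hecke_module_piE icoord_B_op. Qed.

Lemma icoord_Bbar i (v : Bbar_module K s r) g : g \in I ->
  icoord (hpi K i *: v : Bbar_module K s r) g =
    if i \in DesL g then icoord v (s_ i ∘ g) else icoord v g.
Proof. by move=> gI; rewrite hecke_module_piE icoord_Bbar_op. Qed.

End OneInterval.

Lemma mem_conj_interval s r g :
  (conj_longest g \in weak_interval (conj_longest s) (conj_longest r))
    = (g \in weak_interval s r).
Proof. by rewrite !inE !leL_conj_longest. Qed.

Lemma mem_longestr_interval s r g :
  (g ∘ longest n \in weak_interval s r)
    = (g \in weak_interval (r ∘ longest n) (s ∘ longest n)).
Proof.
rewrite !inE -(leL_longestr g (s ∘ _)) -(leL_longestr (r ∘ _) g).
by rewrite !longestK andbC.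
Qed.

Lemma twist_algE (mu : {rmorphism hecke K n -> hecke K n}) s r (k : K)
    (u : twist mu (B_module K s r)) :
  mu k%:A = k%:A -> k%:A *: u = (k *: (u : interval_space K s r) : interval_space K s r).
Proof.
move=> muk; rewrite [LHS]/GRing.scale /= /twist_scale muk.
exact: hecke_module_algE.
Qed.

(** Conjugation by w_0 relabels the basis. *)
Theorem phi_B s r :
  lmod_iso (twist (@hphi K n) (B_module K s r))
           (B_module K (conj_longest s) (conj_longest r)).
Proof.
pose F (v : twist (@hphi K n) (B_module K s r)) :
    B_module K (conj_longest s) (conj_longest r) :=
  vec_of _ _ (fun g => icoord (v : interval_space K s r) (conj_longest g)).
pose G (v : B_module K (conj_longest s) (conj_longest r)) :
    twist (@hphi K n) (B_module K s r) :=
  vec_of _ _ (fun g => icoord (v : interval_space K _ _) (conj_longest g)).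
have mem g : g \in weak_interval (conj_longest s) (conj_longest r) ->
    conj_longest g \in weak_interval s r.
  by rewrite -{1}(conj_longestK g) mem_conj_interval.
have FE v g : icoord (F v : interval_space K _ _) g =
    icoord (v : interval_space K s r) (conj_longest g).
  have [gI|gI] := boolP (g \in weak_interval (conj_longest s) (conj_longest r)).
    exact: icoord_vec_of.
  have gI' : conj_longest g \notin weak_interval s r.
    by rewrite -mem_conj_interval conj_longestK.
  by rewrite (icoord_out _ gI) (icoord_out _ gI').
apply: (@lmod_isoI _ _ _ F); last first.
  exists G => v; apply: icoord_inj => g gI.
    by rewrite (icoord_vec_of _ gI) FE conj_longestK.
  by rewrite FE (icoord_vec_of _ (mem _ gI)) conj_longestK.
apply: hecke_linear => [k u v|i v]; apply: icoord_inj => g gI.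
  rewrite hecke_module_algE icoordP !FE -icoordP; congr (icoord (_ + _) _).
  exact: twist_algE (hphi_alg n k).
rewrite icoord_B // !FE.
have -> : hpi K i *: v = hpi K (rev_ord i) *: (v : B_module K s r).
  have E := congr1 (fun a => a *: (v : B_module K s r)) (hphi_pi K i).
  exact: E.
by rewrite icoord_B ?mem // DesL_conj_longest rev_ordK conj_longest_simple.
Qed.

(** The relabelling multiplies the basis vector of g by the sign of g, as a
    change of sign is needed at every step s_i up the weak order. *)
Theorem theta_B s r :
  lmod_iso (twist (@htheta K n) (B_module K s r)) (Bbar_module K s r).
Proof.
pose sgn (g : 'S_n) : K := (-1) ^+ odd_perm g.
pose F (v : twist (@htheta K n) (B_module K s r)) : Bbar_module K s r :=
  vec_of _ _ (fun g => sgn g * icoord (v : interval_space K s r) g).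
pose G (v : Bbar_module K s r) : twist (@htheta K n) (B_module K s r) :=
  vec_of _ _ (fun g => sgn g * icoord (v : interval_space K s r) g).
have sgnK g x : sgn g * (sgn g * x) = x.
  by rewrite mulrA -signr_addb addbb mul1r.
have FE v g : icoord (F v : interval_space K s r) g =
    sgn g * icoord (v : interval_space K s r) g.
  have [gI|gI] := boolP (g \in weak_interval s r); first exact: icoord_vec_of.
  by rewrite !icoord_out ?mulr0.
apply: (@lmod_isoI _ _ _ F); last first.
  exists G => v; apply: icoord_inj => g gI; first by rewrite icoord_vec_of // FE.
  by rewrite FE icoord_vec_of.
apply: hecke_linear => [k u v|i v]; apply: icoord_inj => g gI.
  rewrite hecke_module_algE icoordP !FE mulrCA -mulrDr -icoordP.
  congr (_ * icoord (_ + _) _).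
  exact: twist_algE (htheta_alg n k).
rewrite icoord_Bbar // !FE.
have -> : hpi K i *: v = (v : B_module K s r) - hpi K i *: (v : B_module K s r).
  have := congr1 (fun a => a *: (v : B_module K s r)) (htheta_pi K i).
  by rewrite /hbarpi opprB scalerBl scale1r => E; exact: E.
rewrite icoordD icoordN icoord_B //; case: ifP => iD; last by rewrite subr0.
rewrite opprD addNKr mulrN /sgn /pcomp odd_permM /simple_tperm odd_tperm.
by rewrite ord_lo_neq_hi addbT signrN mulNr.
Qed.

(** The isomorphism reads off a linear form on the basis of the interval and
    puts its value at g w_0 into the coordinate g.  On the dual basis, pi_i acts
    from a left descent of g down to s_i g, which is a step up after right
    multiplication by w_0. *)
Theorem chi_B s r :
  lmod_iso (dual_twist (@hchi K n) (B_module K s r))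
           (Bbar_module K (r ∘ longest n) (s ∘ longest n)).
Proof.
set M := dual_twist _ _; set N := Bbar_module _ _ _.
have formP (v : N) : (fun u : B_module K s r => \sum_g
    icoord (u : interval_space K s r) g * icoord (v : interval_space K _ _) (g ∘ longest n))
    \in linear_form (B_module K s r).
  apply/asboolP; split=> [u1 u2|k u].
    by rewrite -big_split; apply: eq_bigr => g _ /=; rewrite icoordD mulrDl.
  rewrite mulr_sumr; apply: eq_bigr => g _.
  by rewrite hecke_module_algE icoordZ mulrA.
pose F (d : M) : N := vec_of _ _ (fun g => d (ivec K s r (g ∘ longest n))).
pose G (v : N) : M := DualTwist _ (formP v).
have FE d g : icoord (F d : interval_space K _ _) g = d (ivec K s r (g ∘ longest n)).
  have [gI|gI] := boolP (g \in weak_interval (r ∘ longest n) (s ∘ longest n)).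
    exact: icoord_vec_of.
  rewrite icoord_out // ivec_out; last by rewrite mem_longestr_interval.
  by have /asboolP[_ /(_ 0 0)] := dual_funP d; rewrite mul0r scaler0.
have dE (d : M) (u : B_module K s r) : d u =
    \sum_g icoord (u : interval_space K s r) g * d (ivec K s r g).
  have /asboolP[dD dZ] := dual_funP d.
  rewrite -(sum_interval (fun g => d (ivec K s r g))) {1}[u]ivec_sum.
  rewrite (big_morph _ dD (id1 := 0)); last first.
    by have := dZ 0 0; rewrite mul0r scaler0.
  by apply: eq_bigr => x _; rewrite -dZ hecke_module_algE.
apply: (@lmod_isoI _ _ _ F); last first.
  (* G is the pairing of the two modules given by g |-> g w_0. *)
  exists G => [d|v].
    apply/val_inj/funext => u /=; rewrite [RHS]dE; apply: eq_bigr => g _.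
    by rewrite FE longestK.
  apply: icoord_inj => g gI; rewrite FE /=.
  rewrite (bigD1 (g ∘ longest n)) //= icoord_ivec ?mem_longestr_interval //.
  rewrite eqxx mul1r longestK big1 ?addr0 // => h hg.
  have [hI|hI] := boolP (h \in weak_interval s r).
    by rewrite icoord_ivec // (negPf hg) mul0r.
  by rewrite icoord_out ?mul0r.
apply: hecke_linear => [k d e|i d]; apply: icoord_inj => g gI.
  rewrite hecke_module_algE icoordP !FE /=; congr (_ + _).
  rewrite [X in dual_fun d (X *: _)]hchi_alg.
  by have /asboolP[_ ->] := dual_funP d.
rewrite icoord_Bbar // !FE /= hchi_pi B_moduleE ?mem_longestr_interval //.
rewrite /B_action DesL_longestr pcompA; case: (i \in DesL g) => //=.
case: ifPn => // /ivec_out ->.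
by have /asboolP[_ /(_ 0 0)] := dual_funP d; rewrite mul0r scaler0.
Qed.

End Coordinates.

(** * Products along reduced words *)

Section HeckeBasis.

Variables (K : fieldType) (n : nat).
Implicit Types (s r g h : 'S_n) (i j : 'I_n.-1) (w : seq 'I_n.-1) (J : {set 'I_n.-1}).
Local Notation H := (hecke K n).
Local Notation s_ := (@simple_tperm n).
Local Notation pi := (@hpi K n).
Local Notation pi_ := (@hpi_perm K n).
Local Notation bpi := (@hbarpi K n).
Local Notation bpi_ := (@hbarpi_perm K n).
Local Notation w0 := (longest n).
Local Notation w_ := (@parabolic_longest n).

Lemma reduced_cons i g : i \notin DesL g -> reduced (i :: reduced_word g).
Proof.
move=> iD; rewrite /reduced /= word_perm_reduced_word ell_up //.
by have /eqP := reduced_reduced_word g; rewrite word_perm_reduced_word => ->.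
Qed.

Lemma hpi_perm_up i g : i \notin DesL g -> pi_ (s_ i ∘ g) = pi i * pi_ g.
Proof.
move=> iD; have := hpi_perm_word K (reduced_cons iD).
by rewrite /= word_perm_reduced_word big_cons.
Qed.

Lemma hbarpi_perm_up i g : i \notin DesL g -> bpi_ (s_ i ∘ g) = bpi i * bpi_ g.
Proof.
move=> iD; have := hbarpi_perm_word K (reduced_cons iD).
by rewrite /= word_perm_reduced_word big_cons.
Qed.

Lemma hpi_permL i g : pi i * pi_ g = pi_ (hecke_step i g).
Proof.
rewrite /hecke_step; case: ifPn => iD; last by rewrite hpi_perm_up.
have iD' : i \notin DesL (s_ i ∘ g) by rewrite DesLs iD.
have := hpi_perm_up iD'; rewrite simple_tpermK => ->.
by rewrite mulrA (hecke_rel_idem (hpi_relations K n)).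
Qed.

Lemma hchi_hpi_perm g : hchi (pi_ g) = pi_ (g^-1)%g.
Proof.
have chi_prod w : hchi (\prod_(i <- w) pi i) = \prod_(i <- rev w) pi i.
  elim: w => [|i w IHw]; first by rewrite !big_nil rmorph1.
  by rewrite big_cons hchiM IHw hchi_pi rev_cons -cats1 big_cat big_seq1.
rewrite chi_prod -hpi_perm_word.
  by rewrite word_perm_rev word_perm_reduced_word.
rewrite /reduced word_perm_rev ellV size_rev.
exact: reduced_reduced_word.
Qed.

(** The anti-involution chi exchanges pi_g with the product of the inverse, so
    right multiplication is left multiplication seen through chi. *)
Lemma hpi_permR i g : i \in DesR g -> pi_ g * pi i = pi_ g.
Proof.
move=> iD; apply: (can_inj (@hchiK K n)); rewrite hchiM hchi_pi hchi_hpi_perm.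
by rewrite hpi_permL /hecke_step iD.
Qed.

Lemma hpi_perm_parabolic J g : J \subset DesR g -> pi_ g * pi_ (w_ J) = pi_ g.
Proof.
move=> Jg; have [[w [wJ rw <-]] _] := parabolic_longestP J.
rewrite hpi_perm_word //; elim: w wJ {rw} => [|i w IHw] /=.
  by rewrite big_nil mulr1.
by case/andP=> iJ wJ; rewrite big_cons mulrA hpi_permR ?IHw ?(subsetP Jg).
Qed.

Lemma hpi_barpi i : pi i * bpi i = 0.
Proof. by rewrite /hbarpi mulrBr mulr1 (hecke_rel_idem (hpi_relations K n)) subrr. Qed.

(** The two products meet in a factor pi_i (pi_i - 1) = 0. *)
Lemma hpi_hbarpi_perm0 i g h :
  i \in DesR g -> i \in DesL h -> pi_ g * bpi_ h = 0.
Proof.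
move=> iR iL; rewrite -(hpi_permR iR) -(simple_tpermK i h) hbarpi_perm_up.
  by rewrite mulrA -(mulrA (pi_ g)) hpi_barpi mulr0 mul0r.
by rewrite DesLs iL.
Qed.

Lemma htheta_hpi_perm g : htheta (pi_ g) = (-1) ^+ ell g * bpi_ g.
Proof.
have -> : ell g = size (reduced_word g).
  by have /eqP := reduced_reduced_word g; rewrite word_perm_reduced_word.
rewrite /hpi_perm /hbarpi_perm; elim: (reduced_word g) => [|i w IHw].
  by rewrite !big_nil rmorph1 mul1r.
rewrite !big_cons rmorphM /= IHw htheta_pi exprS !mulrA mulN1r !mulNr.
by congr (- (_ * _)); apply: commr_sign.
Qed.

Lemma leL_DesR s g : leL s g -> DesR s \subset DesR g.
Proof.
have DesRE h i : (i \in DesR h) = (ell (h ∘ s_ i) < ell h)%N.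
  rewrite inE ellV -[ell (s_ i ∘ _)]ellV /pcomp invMg invgK.
  by rewrite /simple_tperm tpermV.
move=> /existsP[u /andP[/eqP -> /eqP e]]; apply/subsetP => i.
by rewrite !DesRE e -pcompA; have := ell_comp u (s ∘ s_ i); lia.
Qed.

Lemma mem_full_interval g : g \in weak_interval 1%g w0.
Proof.
rewrite inE !leLE ell1 addn0 invg1 pcomps1 eqxx /=.
by rewrite -(ell_longestl (g^-1)%g) ellV.
Qed.

Lemma prod_hpi_ivec s r w g : leL s g ->
  (\prod_(i <- w) pi i) *: (ivec K s r g : B_module K s r)
    = ivec K s r (foldr (@hecke_step n) g w).
Proof.
move=> sg; elim: w => [|i w IHw]; first by rewrite big_nil scale1r.
rewrite big_cons -scalerA IHw hecke_module_piE B_op_step //.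
by elim: w {IHw} => //= j w; apply: leL_hecke_step.
Qed.

Lemma foldr_hecke_step w : reduced w -> foldr (@hecke_step n) 1%g w = word_perm w.
Proof.
elim: w => [|i w IHw] //= /eqP rw.
have iD : i \notin DesL (word_perm w).
  apply/negP => /ell_down; have := ell_min w; move: rw => /= ->; lia.
have rw' : reduced w by move: rw; rewrite /reduced /= ell_up // => -[->].
by rewrite IHw // /hecke_step (negPf iD).
Qed.

(* Its basis is the whole symmetric group: it plays the role of the left
   regular module, with 1 as generator. *)
Local Notation Reg := (B_module K (1%g : 'S_n) w0).

Lemma hpi_perm_ivec1 g : pi_ g *: (ivec K _ _ 1%g : Reg) = ivec K _ _ g.
Proof.
rewrite prod_hpi_ivec; last by rewrite leLE invg1 pcomps1 ell1.
by rewrite foldr_hecke_step ?reduced_reduced_word ?word_perm_reduced_word.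
Qed.

End HeckeBasis.

(** * Descent classes are intervals *)

Section ParabolicDescents.

Variable n : nat.
Implicit Types (s r g h : 'S_n) (i j : 'I_n.-1) (w : seq 'I_n.-1) (J : {set 'I_n.-1}).
Local Notation s_ := (@simple_tperm n).
Local Notation w0 := (longest n).
Local Notation w_ := (@parabolic_longest n).

(** If all of J are right descents of g, then pi_g pi_(w_J) = pi_g.  Acting on
    the identity, the right-hand side gives g and the left-hand side something
    above w_J.  The statement does not mention coefficients; the rationals
    serve as the field. *)
Lemma leL_parabolic_longest J g : leL (w_ J) g = (J \subset DesR g).
Proof.
apply/idP/idP => [/leL_DesR|Jg].
  exact: subset_trans (DesR_parabolic_longest J).
have w1 : leL (1%g : 'S_n) (w_ J) by have := mem_full_interval (w_ J); rewrite inE => /andP[].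
have := congr1 (fun a : hecke rat n => a *: (ivec rat _ _ 1%g : B_module rat (1%g : 'S_n) w0))
  (hpi_perm_parabolic rat Jg).
rewrite -scalerA !hpi_perm_ivec1 (prod_hpi_ivec _ _ _ w1).
move=> /(congr1 (fun v : interval_space rat _ _ => icoord v g)).
rewrite !icoord_ivec ?mem_full_interval // eqxx.
case: eqP => [-> _|_ /eqP]; last by rewrite eq_sym oner_eq0.
by elim: (reduced_word g) => [|i w]; [rewrite leLE /pcomp mulVg ell1 | apply: leL_hecke_step].
Qed.

(** Such a g lies above w_J, but is not longer. *)
Lemma parabolic_longest_unique J g :
  gen_word J g -> J \subset DesR g -> g = w_ J.
Proof.
move=> gJ; rewrite -leL_parabolic_longest => /existsP[u /andP[/eqP gE /eqP e]].
have [_ /(_ _ gJ)] := parabolic_longestP J; rewrite e => le.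
have /ell_eq0 u1 : ell u = 0%N by lia.
by rewrite gE u1 pcomp1s.
Qed.

Lemma parabolic_longest_conj J :
  conj_longest (w_ J) = w_ [set i | rev_ord i \in J].
Proof.
apply: parabolic_longest_unique.
  have [[w [wJ _ <-]] _] := parabolic_longestP J.
  have -> : conj_longest (word_perm w) = word_perm (map (@rev_ord _) w).
    elim: w {wJ} => [|i w IHw] /=; last by rewrite conj_longest_simple IHw.
    by rewrite /conj_longest pcomps1 -{2}(longestV n) /pcomp mulVg.
  apply: word_perm_gen_word; rewrite all_map; apply: sub_all wJ => i iJ /=.
  by rewrite inE rev_ordK.
apply/subsetP => i; rewrite inE => iJ.
have -> : DesR (conj_longest (w_ J)) = DesL (conj_longest ((w_ J)^-1)%g).
  by rewrite /DesR /conj_longest /pcomp !invMg longestV mulgA.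
by rewrite DesL_conj_longest (subsetP (DesR_parabolic_longest J)).
Qed.

(** Left multiplication by w_0 complements right descent sets and reverses the
    order, so the upper bound is the lower bound for the complement. *)
Lemma descent_class J g :
  (g \in weak_interval (w_ (~: J)) (w0 ∘ w_ J)) = (DesR g == ~: J).
Proof.
rewrite inE -(leL_longestl g) longestKl !leL_parabolic_longest.
have -> : DesR (w0 ∘ g) = ~: DesR g.
  by apply/setP => i; rewrite in_setC /DesR -DesL_longestr /pcomp invMg longestV.
by rewrite eqEsubset [J \subset _]subsetC andbC.
Qed.

Lemma simple_tperm_inj : injective (@simple_tperm n).
Proof.
move=> i j ij; have := congr1 (fun g : 'S_n => g (ord_lo i)) ij.
rewrite {1}/simple_tperm tpermL /simple_tperm.
case: tpermP => [e|e|_ _] /(congr1 val) /=.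
- by move=> _; apply: val_inj; have := congr1 val e.
- by move/(congr1 val): e => /=; lia.
- by lia.
Qed.

(** By the exchange property, a left descent s_i of g is a product of elements of
    the parabolic subgroup, and a reduced word of s_i has a single letter. *)
Lemma DesL_gen_word J g : gen_word J g -> DesL g \subset J.
Proof.
move=> gJ; apply/subsetP => i iD; have [w [wJ rw wE]] := gJ.
have lt : (ord_lo i < ord_hi i)%N by [].
have := iD; rewrite DesLP -wE => /(exchange lt)[w1 [j [w2 [wE' E]]]].
have : (s_ i \in <<[set s_ k | k in J]>>)%g.
  have -> : s_ i = (g^-1 * (s_ i ∘ g))%g by rewrite /pcomp mulKg.
  rewrite groupM ?groupV ?gen_word_mem // -wE [s_ i ∘ _]E.
  by apply: word_perm_gen_word; move: wJ; rewrite wE' !all_cat /= => /and3P[-> _ ->].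
case/mem_gen_word=> -[|k [|l v]] [vJ rv vE].
- by move/eqP: rv; rewrite vE ell_simple.
- move: vE; rewrite /= pcomps1 => /simple_tperm_inj <-.
  by move: vJ; rewrite /= andbT.
- by move/eqP: rv; rewrite vE ell_simple.
Qed.

Lemma DesR_parabolic_longestE J : DesR (w_ J) = J.
Proof.
apply/eqP; rewrite eqEsubset DesR_parabolic_longest andbT.
by apply/DesL_gen_word/gen_wordV; have [] := parabolic_longestP J.
Qed.

End ParabolicDescents.

(** * Homomorphisms out of interval modules and leading terms *)

Section Homs.

Variables (K : fieldType) (n : nat).
Implicit Types (s r g h : 'S_n) (i j : 'I_n.-1) (w : seq 'I_n.-1) (J : {set 'I_n.-1}).
Local Notation H := (hecke K n).
Local Notation s_ := (@simple_tperm n).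
Local Notation pi := (@hpi K n).
Local Notation bpi := (@hbarpi K n).
Local Notation w0 := (longest n).

Local Notation Reg := (B_module K (1%g : 'S_n) w0).

Lemma B_hom_linear s r (M : lmodType H) (X : 'S_n -> M) :
    (forall i g, g \in weak_interval s r -> pi i *: X g =
       if i \in DesL g then X g
       else if s_ i ∘ g \in weak_interval s r then X (s_ i ∘ g) else 0) ->
  linear (fun v : B_module K s r =>
    \sum_g (icoord (v : interval_space K s r) g)%:A *: X g).
Proof.
move=> XE; set I := weak_interval s r in XE.
have AZ (a : K) (x : M) (i : 'I_n.-1) : pi i *: (a%:A *: x) = a%:A *: (pi i *: x).
  by rewrite !scalerA algC.
apply: hecke_linear => [k u v|i v].
  rewrite scaler_sumr -big_split; apply: eq_bigr => g _ /=.
  rewrite hecke_module_algE icoordP !scalerDl scalerA -scalerAl mul1r.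
  by congr (_ *: _ + _); rewrite scalerA.
pose Y g : M := if g \in I then X g else 0.
transitivity (\sum_(g | i \in DesL g) ((icoord (v : interval_space K s r) g)%:A *: Y g
    + (icoord (v : interval_space K s r) (s_ i ∘ g))%:A *: Y g)).
  rewrite [RHS]big_mkcond; apply: eq_bigr => g _; rewrite /Y.
  have [gI|gI] := boolP (g \in I); last first.
    by rewrite icoord_out // !scaler0 addr0 !scale0r if_same.
  by rewrite icoord_B //; case: ifP => _; rewrite ?scale0r // !scalerDl.
have step g : pi i *: ((icoord (v : interval_space K s r) g)%:A *: X g) =
    (icoord (v : interval_space K s r) g)%:A *: Y (hecke_step i g).
  have [gI|gI] := boolP (g \in I); last by rewrite icoord_out // !scale0r scaler0.
  rewrite AZ XE // /Y /hecke_step; congr (_ *: _).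
  by case: ifP => // _; rewrite gI.
rewrite scaler_sumr (eq_bigr _ (fun g _ => step g)) {step AZ XE}.
rewrite big_split [RHS](bigID (fun g => i \in DesL g)) /=; congr (_ + _).
  by apply: eq_bigr => g iD; rewrite /hecke_step iD.
rewrite [RHS](reindex_inj (can_inj (simple_tpermK i))) /=.
rewrite [RHS](eq_bigl (fun g => i \in DesL g)); last first.
  by move=> g; rewrite DesLs negbK.
apply: eq_bigr => g iD.
by rewrite /hecke_step DesLs iD simple_tpermK.
Qed.

Section Leading.

Variable g : 'S_n.

(** The vector is c g plus a combination of longer permutations. *)
Definition leading (c : K) (v : Reg) : Prop :=
  icoord (v : interval_space K _ _) g = c /\
  (forall h, h != g -> (ell h <= ell g)%N -> icoord (v : interval_space K _ _) h = 0).

Lemma leading_ivec : leading 1 (ivec K _ _ g).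
Proof.
split=> [|h hg _]; rewrite icoord_ivec ?mem_full_interval ?eqxx //.
by rewrite (negPf hg).
Qed.

(** Coefficients only move up in length, and at a descent of g nothing reaches
    g from s_j g, which is shorter. *)
Lemma leading_hpi j c v : j \in DesL g -> leading c v -> leading c (pi j *: v).
Proof.
move=> jD [vg vh]; have low h : (ell h <= ell g)%N -> j \in DesL h ->
    icoord (v : interval_space K _ _) (s_ j ∘ h) = 0.
  move=> hg /ell_down e; apply: vh; last by lia.
  by apply: contraTneq hg => e'; rewrite e e' -ltnNge.
split=> [|h hg hl]; rewrite icoord_B ?mem_full_interval //.
  by rewrite jD vg low ?addr0.
by case: ifP => // jh; rewrite vh // low // addr0.
Qed.

(** At an ascent of g, pi_i moves g to a longer permutation, so only the -1 of
    pi_i - 1 contributes to the coefficient of g. *)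
Lemma leading_hbarpi i c v :
  i \notin DesL g -> leading c v -> leading (- c) (bpi i *: v).
Proof.
move=> iD [vg vh]; rewrite /hbarpi scalerBl scale1r; split=> [|h hg hl].
  rewrite icoordD icoordN icoord_B ?mem_full_interval // (negPf iD) vg.
  by rewrite add0r.
rewrite icoordD icoordN icoord_B ?mem_full_interval // (vh _ hg hl) subr0.
case: ifP => // ih; rewrite add0r; have e := ell_down ih.
by apply: vh; [apply: contraTneq hl => e'; rewrite e e' -ltnNge | lia].
Qed.

End Leading.

End Homs.

(** * The projective modules as interval modules *)

Section Projective.

Variables (K : fieldType) (n : nat).
Implicit Types (s r g h : 'S_n) (i j : 'I_n.-1) (w : seq 'I_n.-1) (J : {set 'I_n.-1}).
Local Notation H := (hecke K n).
Local Notation s_ := (@simple_tperm n).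
Local Notation pi := (@hpi K n).
Local Notation pi_ := (@hpi_perm K n).
Local Notation bpi := (@hbarpi K n).
Local Notation bpi_ := (@hbarpi_perm K n).
Local Notation w0 := (longest n).
Local Notation w_ := (@parabolic_longest n).
Local Notation Reg := (B_module K (1%g : 'S_n) w0).

Lemma leading_prod_hpi g c w v : all (mem (DesL g)) w -> leading g c v ->
  leading g c ((\prod_(i <- w) pi i) *: v : Reg).
Proof.
elim: w => [|i w IHw] /=; first by rewrite big_nil scale1r.
by case/andP=> iD wD gv; rewrite big_cons -scalerA; apply/leading_hpi/IHw.
Qed.

Lemma leading_prod_hbarpi g c w v : all (mem (~: DesL g)) w -> leading g c v ->
  leading g ((-1) ^+ size w * c) ((\prod_(i <- w) bpi i) *: v : Reg).
Proof.
elim: w => [|i w IHw] /=; first by rewrite big_nil scale1r mul1r.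
case/andP=> iD wD gv; rewrite big_cons -scalerA exprS mulN1r mulNr.
by apply/leading_hbarpi/IHw => //; rewrite in_setC in iD.
Qed.

Lemma hchi_prod_hbarpi w :
  hchi (\prod_(i <- w) bpi i) = \prod_(i <- rev w) bpi i.
Proof.
elim: w => [|i w IHw]; first by rewrite !big_nil rmorph1.
rewrite big_cons hchiM IHw rev_cons -cats1 big_cat big_seq1; congr (_ * _).
by rewrite /hbarpi rmorphB rmorph1 /= hchi_pi.
Qed.

(** Applying chi reverses the product, so that the factors act on g^-1, whose
    left descents are the right descents of g: those of bar pi_(w_J) are
    ascents and those of pi_(w_(J^c)) descents. *)
Lemma leading_chi J g : DesR g = ~: J -> exists2 c : K, c != 0 &
  leading (g^-1)%g c ((hchi (pi_ g * bpi_ (w_ J) * pi_ (w_ (~: J))) : H)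
                     *: (ivec K _ _ 1%g : Reg)).
Proof.
move=> gJ; have [[u [uJ ru uE]] _] := parabolic_longestP J.
have [[v [vJ rv vE]] _] := parabolic_longestP (~: J).
exists ((-1) ^+ size (rev u) * 1); first by rewrite mulr1 signr_eq0.
rewrite hchiM hchi_hpi_perm -vE -word_perm_rev hchiM hchi_hpi_perm.
rewrite -uE hbarpi_perm_word // hchi_prod_hbarpi -!scalerA hpi_perm_ivec1.
rewrite hpi_perm_word; last first.
  by rewrite /reduced word_perm_rev ellV size_rev.
apply: leading_prod_hpi; first by rewrite all_rev -/(DesR g) gJ.
apply: leading_prod_hbarpi; last exact: leading_ivec.
by rewrite all_rev -/(DesR g) gJ setCK.
Qed.

Definition P_hom J (v : B_module K (w_ (~: J)) (w0 ∘ w_ J)) : H^o :=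
  \sum_g (icoord (v : interval_space K _ _) g)%:A *: (pi_ g * bpi_ (w_ J) : H^o).

(** If s_i g leaves the descent class, then it has gained a right descent in J,
    and bar pi_(w_J) kills it. *)
Lemma P_hom_linear J : linear (@P_hom J).
Proof.
apply: B_hom_linear => i g; rewrite descent_class => /eqP gJ.
rewrite [LHS]mulrA hpi_permL /hecke_step; case: ifPn => // iD.
case: ifPn => //; rewrite descent_class => sgJ.
have gs : leL g (s_ i ∘ g) by have := leL_step i g; rewrite /hecke_step (negPf iD).
have : ~~ (DesR (s_ i ∘ g) \subset ~: J).
  by apply: contra sgJ => sub; rewrite eqEsubset sub -gJ leL_DesR.
case/subsetPn => j jR; rewrite in_setC negbK => jJ.
exact: hpi_hbarpi_perm0 jR (subsetP (DesL_parabolic_longest J) j jJ).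
Qed.

(** Among the g with a nonzero coordinate in v, one of minimal length cannot be
    cancelled, because g^-1 is the shortest term in the contribution of g. *)
Lemma P_hom_mul_inj J v : @P_hom J v * pi_ (w_ (~: J)) = 0 -> v = 0.
Proof.
set I := weak_interval (w_ (~: J)) (w0 ∘ w_ J) => Pv.
pose c g := icoord (v : interval_space K _ _) g.
suff c0 g : c g = 0 by apply: (@icoord_inj K n _ _ v 0) => g _; rewrite icoord0; apply: c0.
apply/eqP/negPn/negP => cg.
case: (@arg_minnP _ g (fun h => c h != 0) (@ell n) cg) => {cg}g cg gmin.
have gJ : DesR g = ~: J.
  apply/eqP; rewrite -descent_class; apply: contraNT cg => gI.
  by rewrite /c icoord_out.
pose u h : Reg := (hchi (pi_ h * bpi_ (w_ J) * pi_ (w_ (~: J))) : H)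
                     *: (ivec K _ _ 1%g : Reg).
have : \sum_h c h * icoord (u h : interval_space K _ _) (g^-1)%g = 0.
  have := congr1 (fun a => (hchi a : H) *: (ivec K _ _ 1%g : Reg)) Pv.
  rewrite rmorph0 scale0r /P_hom mulr_suml rmorph_sum scaler_suml.
  move=> /(congr1 (fun x : interval_space K _ _ => icoord x (g^-1)%g)).
  rewrite icoord0 icoord_sum => E0; rewrite -[RHS]E0; apply: eq_bigr => h _.
  rewrite -icoordZ -hecke_module_algE; congr icoord.
  rewrite /u scalerA; apply/esym.
  have E : hchi ((c h)%:A * (pi_ h * bpi_ (w_ J)) * pi_ (w_ (~: J))) =
      (c h)%:A * (hchi (pi_ h * bpi_ (w_ J) * pi_ (w_ (~: J))) : H) :> H.
    by rewrite -mulrA mulr_algl hchiZ mulr_algl.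
  exact: (congr1 (fun a : H => a *: (ivec K _ _ 1%g : Reg)) E).
rewrite (bigD1 g) //= big1 ?addr0 => [|h hg]; last first.
  have [->|ch] := eqVneq (c h) 0; first by rewrite mul0r.
  have hJ : DesR h = ~: J.
    apply/eqP; rewrite -descent_class; apply: contraNT ch => hI.
    by rewrite /c icoord_out.
  have [b _ [_ ->]] := leading_chi hJ; first by rewrite mulr0.
    by rewrite (inj_eq invg_inj) eq_sym.
  by rewrite !ellV gmin.
have [b b0 [-> _]] := leading_chi gJ.
by move/eqP; rewrite mulf_eq0 (negPf cg) (negPf b0).
Qed.

Lemma P_hom_ivec J : P_hom (ivec K _ _ (w_ (~: J)) : B_module K (w_ (~: J)) (w0 ∘ w_ J))
  = pi_ (w_ (~: J)) * bpi_ (w_ J).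
Proof.
have wI : w_ (~: J) \in weak_interval (w_ (~: J)) (w0 ∘ w_ J).
  by rewrite descent_class DesR_parabolic_longestE.
rewrite /P_hom (bigD1 (w_ (~: J))) //= icoord_ivec // eqxx !scale1r big1 ?addr0 // => g gw.
have [gI|gI] := boolP (g \in weak_interval (w_ (~: J)) (w0 ∘ w_ J)).
  by rewrite icoord_ivec // (negPf gw) scale0r scale0r.
by rewrite icoord_out // !scale0r.
Qed.

(** With J = set(alpha) this is the projective module of alpha; see
    [P_moduleE]. *)
Definition P_ideal J : lmodType H := left_ideal (pi_ (w_ (~: J)) * bpi_ (w_ J)).

Lemma P_hom_in_ideal J v : @P_hom J v \in left_ideal_pred (pi_ (w_ (~: J)) * bpi_ (w_ J)).
Proof.
apply/asboolP; exists (\sum_g icoord (v : interval_space K _ _) g *: pi_ g).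
rewrite mulrA mulr_suml /P_hom mulr_suml; apply: eq_bigr => g _.
have [gI|gI] := boolP (g \in weak_interval (w_ (~: J)) (w0 ∘ w_ J)); last first.
  by rewrite icoord_out // !scale0r !mul0r.
rewrite [LHS]mulr_algl -!scalerAl; congr (_ *: (_ * _)).
move: gI; rewrite inE leL_parabolic_longest => /andP[Jg _].
by rewrite hpi_perm_parabolic.
Qed.

Theorem B_P_ideal J : lmod_iso (B_module K (w_ (~: J)) (w0 ∘ w_ J)) (P_ideal J).
Proof.
pose F (v : B_module K (w_ (~: J)) (w0 ∘ w_ J)) : P_ideal J := LeftIdeal (P_hom_in_ideal v).
have Flin : linear F by move=> a u v; apply: val_inj; apply: P_hom_linear.
apply: (lmod_isoI Flin); apply: inj_surj_bij => [u v uv|x].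
  have Puv : P_hom u = P_hom v by have := congr1 val uv.
  apply/eqP; rewrite -subr_eq0; apply/eqP/P_hom_mul_inj.
  by rewrite addrC -scaleN1r P_hom_linear Puv scaleN1r addNr mul0r.
have /asboolP[a ax] := left_ideal_valP x.
exists (a *: (ivec K _ _ (w_ (~: J)) : B_module K _ _)); apply: val_inj => /=.
have P0 : @P_hom J 0 = 0.
  by have := P_hom_linear (-1) 0 (0 : B_module K (w_ (~: J)) (w0 ∘ w_ J)); rewrite scaler0 addr0 scaleN1r addNr.
have := P_hom_linear a (ivec K _ _ (w_ (~: J)) : B_module K (w_ (~: J)) (w0 ∘ w_ J)) 0.
by rewrite P0 !addr0 => ->; rewrite P_hom_ivec ax.
Qed.

End Projective.

(** * The projective modules as negative interval modules *)

Lemma lfun_inj_surj (K : fieldType) (V W : vectType K) (f : 'Hom(V, W)) :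
  injective f -> \dim {:V} = \dim {:W} -> forall y, exists x, f x = y.
Proof.
move=> /lker0P/eqP f0 dVW y.
have : limg f == fullv.
  by rewrite eqEdim subvf limg_dim_eq /= ?dVW ?leqnn ?f0 ?capv0.
by move/eqP=> fE; have /memv_imgP[x _ ->] : y \in limg f; [rewrite fE memvf | exists x].
Qed.

Lemma card_longestl_interval n (s r : 'S_n) :
  #|weak_interval (longest n ∘ r) (longest n ∘ s)| = #|weak_interval s r|.
Proof.
rewrite -[LHS](card_imset _ (can_inj (@longestKl n))).
rewrite (can2_imset_pre _ (@longestKl n) (@longestKl n)).
by apply: eq_card => g; rewrite !inE !leL_longestl andbC.
Qed.

Lemma dim_interval_space (K : fieldType) n (s r : 'S_n) :
  \dim {: interval_space K s r} = #|weak_interval s r|.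
Proof.
rewrite dimvf; transitivity (#|{: {g : 'S_n | g \in weak_interval s r}}| * 1)%N => //.
by rewrite card_sig muln1; apply: eq_card.
Qed.

Lemma hpi_perm_htheta (K : fieldType) n (g : 'S_n) :
  hpi_perm K g = (-1) ^+ ell g * htheta (hbarpi_perm K g).
Proof.
apply: (can_inj (@hthetaK K n)); rewrite rmorphM /= hthetaK rmorph_sign.
exact: htheta_hpi_perm.
Qed.

Section ThetaP.

Variables (K : fieldType) (n : nat) (J : {set 'I_n.-1}).
Local Notation H := (hecke K n).
Local Notation pi_ := (@hpi_perm K n).
Local Notation bpi_ := (@hbarpi_perm K n).
Local Notation w0 := (longest n).
Local Notation w_ := (@parabolic_longest n).
Local Notation M := (twist (@htheta K n) (B_module K (w_ (~: J)) (w0 ∘ w_ J))).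

(** The twisted copy of H pi_(w_(J^c)) bar pi_(w_J) is
    H bar pi_(w_(J^c)) pi_(w_J); right multiplication by bar pi_(w_(J^c)) moves
    it into the projective module of the complement of J. *)
Lemma theta_P_hom_in_ideal (v : M) :
  (htheta (P_hom v : H) * bpi_ (w_ (~: J)) : H^o)
    \in left_ideal_pred (pi_ (w_ (~: ~: J)) * bpi_ (w_ (~: J))).
Proof.
have /asboolP[a ->] := P_hom_in_ideal v.
have -> : htheta (a * (pi_ (w_ (~: J)) * bpi_ (w_ J)))
    = htheta (a * pi_ (w_ (~: J))) * ((-1) ^+ ell (w_ J) * pi_ (w_ J)).
  by rewrite (hpi_perm_htheta K (w_ J)) signrMK mulrA rmorphM.
by apply/asboolP; eexists; rewrite setCK !mulrA.
Qed.

Definition theta_P_hom (v : M) : P_ideal K (~: J) := LeftIdeal (theta_P_hom_in_ideal v).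

Lemma theta_P_hom_linear : linear theta_P_hom.
Proof.
move=> a u v; apply: val_inj; rewrite /=.
have E : P_hom (a *: u + v) = (htheta a : H) * (P_hom (u : B_module K _ _) : H) + P_hom v :> H.
  exact: P_hom_linear.
rewrite E rmorphD rmorphM /= hthetaK mulrDl.
by rewrite -mulrA.
Qed.

(** Undoing theta turns the factor bar pi into pi, up to sign, and gives the
    injectivity already known. *)
Lemma theta_P_hom_inj : injective theta_P_hom.
Proof.
move=> u v uv; apply/eqP; rewrite -subr_eq0; apply/eqP.
apply: (@P_hom_mul_inj K n J (u - v)).
have e : htheta (P_hom (u - v : M) : H) * bpi_ (w_ (~: J)) = 0.
  change (val (theta_P_hom (u - v)) = 0).
  by rewrite addrC -scaleN1r theta_P_hom_linear uv scaleN1r addNr.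
rewrite hpi_perm_htheta mulrA commr_sign -mulrA.
by rewrite -[X in X * htheta _]hthetaK -rmorphM /= e rmorph0 mulr0.
Qed.

(** Surjectivity by dimension: the target is an interval module as well, on the
    image of the first interval under left multiplication by w_0. *)
Theorem theta_B_P_ideal : lmod_iso M (P_ideal K (~: J)).
Proof.
apply: (lmod_isoI theta_P_hom_linear); apply: inj_surj_bij; first exact: theta_P_hom_inj.
have [f [h fK hK]] := B_P_ideal K (~: J).
pose V := interval_space K (w_ (~: J)) (w0 ∘ w_ J).
pose W := interval_space K (w_ (~: ~: J)) (w0 ∘ w_ (~: J)).
pose G (v : V) : W := h (theta_P_hom v).
have hlin : linear h by exact: can2_linear fK hK.
have Glin : linear G.
  move=> k u v; rewrite /G.
  have kE : k%:A *: (u : M) = (k *: u : V) by exact: twist_algE (htheta_alg n k).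
  have := congr1 h (theta_P_hom_linear k%:A (u : M) (v : M)).
  rewrite kE hlin hecke_module_algE => E; exact: E.
pose GL : {linear V -> W} := HB.pack G (GRing.isLinear.Build K V W *:%R G Glin).
have GI : injective (linfun GL).
  move=> u v; rewrite !lfunE /= => /(can_inj hK); exact: theta_P_hom_inj.
move=> x; have [|v] := lfun_inj_surj GI _ (h x).
  apply: etrans (dim_interval_space _ _ _) (etrans _ (esym (dim_interval_space _ _ _))).
  rewrite setCK -{2}(longestKl (w_ J)).
  exact/esym/card_longestl_interval.
by rewrite lfunE => /(can_inj hK) vx; exists v.
Qed.

End ThetaP.

(** * Duality of the projective modules *)

Theorem chi_P_ideal (K : fieldType) n (J : {set 'I_n.-1}) :
  lmod_iso (dual_twist (@hchi K n) (P_ideal K J))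
           (P_ideal K [set i | rev_ord i \in J]).
Proof.
set J' := [set i | _].
have w0J (I : {set 'I_n.-1}) : parabolic_longest I ∘ longest n
    = longest n ∘ parabolic_longest [set i | rev_ord i \in I].
  by rewrite -parabolic_longest_conj /conj_longest -!pcompA longestKl.
have E : [set i | rev_ord i \in ~: J] = ~: J' by apply/setP => i; rewrite !inE.
apply: lmod_iso_trans (lmod_iso_dual _ (B_P_ideal K J)) _.
apply: lmod_iso_trans (chi_B K _ _) _.
rewrite w0J E -/(conj_longest _) parabolic_longest_conj -/J'.
apply: lmod_iso_trans (lmod_iso_sym (theta_B K _ _)) _.
by have := theta_B_P_ideal K (~: J'); rewrite setCK.
Qed.

(** * Reversal of compositions *)

Lemma mem_scanl_addn k x t : (k \in scanl addn x t) =
  [exists j : 'I_(size t), k == x + sumn (take j.+1 t)]%N.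
Proof.
elim: t x => [|y t IHt] x /=.
  by apply/esym/existsP => -[[]].
rewrite inE IHt; apply/orP/existsP.
  case=> [/eqP->|/existsP[j /eqP->]].
    by exists ord0; rewrite /= take0 /= addn0.
  by exists (lift ord0 j); rewrite lift0 /= addnA.
case=> -[[|j] jt] /=; first by rewrite take0 /= addn0; left.
move=> e; right; apply/existsP.
by exists (Ordinal (jt : j < size t)%N); rewrite /= -addnA.
Qed.

Lemma comp_set_rev n (a : composition n) :
  comp_set (comp_rev a) = [set i | rev_ord i \in comp_set a].
Proof.
have sub (b : composition n) i : i \in comp_set b -> rev_ord i \in comp_set (comp_rev b).
  have /andP[_ /eqP sb] := cpartsP b.
  rewrite !inE /= !mem_scanl_addn => /existsP[j /eqP]; rewrite add0n => ij.
  have jl : (j.+1 < size (cparts b))%N.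
    rewrite ltn_neqAle ltn_ord andbT; apply/eqP => e; move: ij.
    by rewrite e take_size sb; have := ltn_ord i; lia.
  have kl : (size (cparts b) - j.+2 < size (rev (cparts b)))%N.
    by rewrite size_rev; lia.
  apply/existsP; exists (Ordinal kl); rewrite add0n /= take_rev sumn_rev.
  have -> : (size (cparts b) - (size (cparts b) - j.+2).+1 = j.+1)%N by lia.
  have := congr1 sumn (cat_take_drop j.+1 (cparts b)).
  rewrite sumn_cat sb -ij; have := ltn_ord i; lia.
apply/setP => i; rewrite [in RHS]inE; apply/idP/idP => [/sub|/sub].
  suff -> : comp_rev (comp_rev a) = a by [].
  case: a => p pP; rewrite /comp_rev /=.
  by move: (comp_rev_subproof _) => /=; rewrite revK => pP'; congr Composition; apply: bool_irrelevance.
by rewrite rev_ordK.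
Qed.

Lemma P_moduleE (K : fieldType) n (a : composition n) :
  P_module K a = P_ideal K (comp_set a).
Proof. by rewrite /P_module comp_set_compl. Qed.

Local Open Scope complex_scope.

Theorem theorem3p16 (R : realType) (n : nat) :
  (forall s r : 'S_n,
    [/\ lmod_iso (twist (@hphi R[i] n) (B_module R[i] s r))
                 (B_module R[i] (conj_longest s) (conj_longest r)),
        lmod_iso (twist (@htheta R[i] n) (B_module R[i] s r))
                 (Bbar_module R[i] s r)
      & lmod_iso (dual_twist (@hchi R[i] n) (B_module R[i] s r))
                 (Bbar_module R[i] (r ∘ longest n) (s ∘ longest n))]) /\
  (forall a : composition n,
    lmod_iso (dual_twist (@hchi R[i] n) (P_module R[i] a))
             (P_module R[i] (comp_rev a))).
Proof.
split=> [s r|a]; first by split; [exact: phi_B | exact: theta_B | exact: chi_B].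
by rewrite !P_moduleE comp_set_rev; apply: chi_P_ideal.
Qed.
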